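(* Let $n\in\mathbb{N}$. The determinant of the Laplacian on the even-dimensional unit sphere $\mathbb{S}^{2n}$ satisfies $$-\log\left[\det\left(\mathbb{S}^{2n}\right)\right]=\zeta'_{\mathbb{S}^{2n}}(0)=\frac{2}{(2n-1)!}\sum_{k=1}^{n}\zeta'(-2k+1)\big(s(2n-1,2k-1)+s(2n,2k)\big)+\sum_{i=1}^{n}\bar v(n,i)\frac{(2n-1)^{2i}}{2i}\left(\frac{H_{i-1}}{2}-H_{2i-1}\right)+\log(2n-1).$$
   Context: $\mathbb{N}=\{1,2,3,\dots\}$, $\zeta$ is the Riemann zeta function with derivative $\zeta'$, and $H_m=\sum_{k=1}^m \frac1k$ (with $H_0=0$). For $N\ge 1$, the positive eigenvalues of the Laplacian on the unit sphere $\mathbb{S}^{N}$ (standard metric) are $k(k+N-1)$, $k=1,2,\dots$, with multiplicities $m_k^N=(2k+N-1)\frac{(k+N-2)!}{k!\,(N-1)!}$. The spectral zeta function is $\zeta_{\mathbb{S}^N}(s)=\sum_{k=1}^\infty m_k^N\,(k(k+N-1))^{-s}$ for $\mathrm{Re}(s)$ large, extended meromorphically to $\mathbb{C}$; it is analytic at $s=0$, and the determinant is $\det(\mathbb{S}^N):=e^{-\zeta_{\mathbb{S}^N}'(0)}$. The (signed) Stirling numbers of the first kind $s(n,k)$ are defined by $x(x-1)\cdots(x-n+1)=\sum_{k=0}^n s(n,k)x^k$. The central factorial numbers with odd indices $v(n,k)$ ($n\ge1$) are given by $\sum_{k=1}^n v(n,k)x^k=x\prod_{i=1}^{n-1}\big(x-(2i-1)^2\big)$,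 and $\bar v(n,k):=\frac{4^{-(n-1)}}{(2n-1)!}v(n,k)$. *)

(* Defs.v *)
From Stdlib Require Import Reals ZArith List Lia Lra.
From Coquelicot Require Import Coquelicot.
Import ListNotations.
Open Scope R_scope.

Definition Cexp (z : C) : C :=
  (exp (Re z) * cos (Im z), exp (Re z) * sin (Im z)).

(* [x ^ s] for a positive real base [x], with the real logarithm. *)
Definition Cpow_pos (x : R) (s : C) : C := Cexp (s * RtoC (ln x))%C.

Definition analytic_at (f : C -> C) (z0 : C) : Prop :=
  exists (a : nat -> C) (r : posreal), forall z : C,
    Cmod (z - z0)%C < r ->
    @is_pseries C_AbsRing C_NormedModule a (z - z0)%C (f z).

(* [f] has at most a pole at [z0].  The value [f z0] is irrelevant when [f] is
   not analytic at [z0]: functions are total, so a value is always present at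
   a pole. *)
Definition meromorphic_at (f : C -> C) (z0 : C) : Prop :=
  exists m : nat, analytic_at (fun z => ((z - z0) ^ m * f z)%C) z0.

(* The Riemann zeta function; these conditions determine [zeta s] for every
   [s <> 1].  The summation index is shifted so as to start at 1. *)
Definition is_Riemann_zeta (zeta : C -> C) : Prop :=
  (forall s : C, meromorphic_at zeta s) /\
  (forall s : C, s <> RtoC 1 -> analytic_at zeta s) /\
  (forall s : C, 1 < Re s ->
     @is_series C_AbsRing C_NormedModule
       (fun j => Cpow_pos (INR (S j)) (- s)%C) (zeta s)).

Definition sphere_eigenvalue (N k : nat) : R := INR (k * (k + N - 1)).

Definition sphere_multiplicity (N k : nat) : R :=
  INR (2 * k + N - 1) * (INR (fact (k + N - 2)) / INR (fact k * fact (N - 1))).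

(* The spectral zeta function of the unit sphere S^N, [1 <= N]: the meromorphic
   continuation, analytic at 0, of the Dirichlet series of the positive
   eigenvalues, with the summation index shifted so as to start at 1.  These conditions determine [Zs] wherever it is analytic, in
   particular near 0. *)
Definition is_sphere_zeta (N : nat) (Zs : C -> C) : Prop :=
  (forall s : C, meromorphic_at Zs s) /\
  analytic_at Zs (RtoC 0) /\
  (exists sigma : R, forall s : C, sigma < Re s ->
     @is_series C_AbsRing C_NormedModule
       (fun j => RtoC (sphere_multiplicity N (S j)) *
                 Cpow_pos (sphere_eigenvalue N (S j)) (- s))%C
       (Zs s)).

Definition zeta_det (Zs : C -> C) : C := Cexp (- C_derive Zs (RtoC 0))%C.

Definition harmonic (m : nat) : R := sum_n_m (fun k => / INR k) 1 m.

(* [root_poly l k] is the coefficient of [x ^ k] in the product of the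
   [x - a] for [a] in [l]. *)
Fixpoint root_poly (l : list Z) : nat -> Z :=
  match l with
  | [] => fun k => if Nat.eqb k 0 then 1%Z else 0%Z
  | a :: l' => fun k =>
      (match k with 0%nat => 0 | S j => root_poly l' j end
       - a * root_poly l' k)%Z
  end.

Definition stirling1 (n : nat) : nat -> Z :=
  root_poly (map Z.of_nat (seq 0 n)).

(* Only meaningful for [1 <= n], see [cfact_odd_spec]. *)
Definition cfact_odd (n k : nat) : Z :=
  match k with
  | 0%nat => 0%Z
  | S j => root_poly
             (map (fun i => ((2 * Z.of_nat i - 1) ^ 2)%Z) (seq 1 (n - 1))) j
  end.

Definition cfact_odd_bar (n k : nat) : R :=
  / 4 ^ (n - 1) / INR (fact (2 * n - 1)) * IZR (cfact_odd n k).

Ltac ring_R := match goal with |- ?a = ?b => change (@eq R a b); ring end.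

Lemma root_poly_large (l : list Z) (k : nat) :
  (length l < k)%nat -> root_poly l k = 0%Z.
Proof.
  revert k; induction l as [|a l IH]; intros k Hk; simpl in *.
  - now destruct k; [lia|].
  - destruct k as [|k]; [lia|]. rewrite !IH by lia. ring.
Qed.

Lemma root_poly_spec (l : list Z) (x : R) :
  sum_n (fun k => IZR (root_poly l k) * x ^ k) (length l) =
  fold_right Rmult 1 (map (fun a => x - IZR a) l).
Proof.
  induction l as [|a l IH].
  - simpl. rewrite sum_O. simpl. ring.
  - change (length (a :: l)) with (S (length l)).
    change (fold_right Rmult 1 (map (fun a => x - IZR a) (a :: l)))
      with ((x - IZR a) * fold_right Rmult 1 (map (fun a => x - IZR a) l)).
    rewrite <- IH.
    set (f := fun k => IZR (root_poly l k) * x ^ k).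
    set (g := fun k => match k with 0%nat => 0
                       | S j => IZR (root_poly l j) * x ^ S j end).
    rewrite (sum_n_ext _ (fun k => plus (g k) (mult (- IZR a) (f k)))).
    + rewrite sum_n_plus, (sum_n_mult_l (K := R_Ring)), (sum_Sn f).
      replace (f (S (length l))) with 0
        by (unfold f; rewrite root_poly_large by lia; ring).
      replace (sum_n g (S (length l))) with (x * sum_n f (length l)).
      * unfold plus, mult, sum_n; simpl. ring_R.
      * unfold sum_n. rewrite (sum_Sn_m g) by lia. rewrite <- sum_n_m_S.
        rewrite (sum_n_m_ext (fun k => g (S k)) (fun k => mult x (f k))).
        -- rewrite (sum_n_m_mult_l (K := R_Ring)).
           symmetry. apply Rplus_0_l.
        -- intro k. unfold g, f, mult; simpl. ring_R.
    + intro k. unfold f, g, plus, mult; simpl.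
      rewrite minus_IZR, mult_IZR. destruct k; simpl; ring_R.
Qed.

Lemma stirling1_spec (n : nat) (x : R) :
  sum_n (fun k => IZR (stirling1 n k) * x ^ k) n =
  fold_right Rmult 1 (map (fun i => x - INR i) (seq 0 n)).
Proof.
  assert (H := root_poly_spec (map Z.of_nat (seq 0 n)) x).
  rewrite length_map, length_seq, map_map in H.
  unfold stirling1. rewrite H. f_equal. apply map_ext. intro i.
  now rewrite INR_IZR_INZ.
Qed.

Lemma cfact_odd_spec (n : nat) (x : R) : (1 <= n)%nat ->
  sum_n_m (fun k => IZR (cfact_odd n k) * x ^ k) 1 n =
  x * fold_right Rmult 1 (map (fun i => x - (2 * INR i - 1) ^ 2) (seq 1 (n - 1))).
Proof.
  intro Hn. destruct n as [|n]; [lia|].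
  replace (S n - 1)%nat with n by lia.
  assert (H := root_poly_spec
    (map (fun i => ((2 * Z.of_nat i - 1) ^ 2)%Z) (seq 1 n)) x).
  rewrite length_map, length_seq, map_map in H.
  rewrite <- sum_n_m_S. unfold cfact_odd. replace (S n - 1)%nat with n by lia.
  rewrite (sum_n_m_ext _ (fun k => mult x (IZR (root_poly
    (map (fun i => ((2 * Z.of_nat i - 1) ^ 2)%Z) (seq 1 n)) k) * x ^ k))).
  - rewrite (sum_n_m_mult_l (K := R_Ring)).
    etransitivity; [exact (f_equal (Rmult x) H)|].
    f_equal. f_equal. apply map_ext. intro i.
    replace ((2 * Z.of_nat i - 1) ^ 2)%Z
      with ((2 * Z.of_nat i - 1) * (2 * Z.of_nat i - 1))%Z by ring.
    rewrite mult_IZR, minus_IZR, mult_IZR, <- INR_IZR_INZ. ring.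
  - intro k. unfold mult; simpl. ring_R.
Qed.

(* Main.v *)
Require Import Defs.
From Stdlib Require Import Reals ZArith List Lra Lia Classical IndefiniteDescription.
From Coquelicot Require Import Coquelicot.
Open Scope R_scope.

(** Put [a = n - 1/2] and [x = k + a].  The eigenvalue is [x^2 - a^2], and the
    multiplicity is an odd polynomial [P(x)], the sum of the
    [vbar(n,i) (2x)^(2i-1)].  As [P(k+a) + P(k-a)] is the polynomial whose
    coefficients are the sums of Stirling numbers, the sum of
    [P(x) ((x-a)^(-s) + (x+a)^(-s))] is a combination of shifted Riemann zeta
    functions minus [(2n-1)^(-s)]: this yields the terms with [zeta'] and
    [log(2n-1)].  The rest, the sum of
    [P(x) ((x^2-a^2)^(-s) - (x-a)^(-s) - (x+a)^(-s))], is expanded in [a/x] by the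
    binomial series.  With [g_l(s) = s(s+1)...(s+l-1)/l!] and [W(s)] the sum of the
    [x^(-s)], the [l]-th term for the summand [i] is a multiple of
    [g_l(s) W(2s+2l-2i+1) - 2 g_{2l}(s) W(s+2l-2i+1)].  Its derivative at 0
    vanishes, except for [l = i], where the simple pole of [W] at 1 leaves
    [(H_{i-1}/2 - H_{2i-1})/i].  The terms with large [l] add up to a function which
    is analytic near 0 and [O(s^2)] there.

    Only restrictions to the real axis are needed: the identity is obtained for
    large real [s] and continued to 0 by the identity theorem for power series in
    one real variable. *)

(** The powers (x-a)^(-s) and (x+a)^(-s) are subtracted because log(x^2-a^2) = log(x-a) + log(x+a):
    for each fixed [x] the difference has derivative 0 at s = 0. The sum with harmonic numbers is
    thus invisible at any single [x]; it stems from the divergence of the sum over [x], where a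
    simple zero of a binomial coefficient meets the pole of [W]. The constant term of [W] at this
    pole is never computed: it enters g_i(s) W(2s+1) and 2 g_{2i}(s) W(s+1) with the same weight 1/i
    and cancels.

    Functions being total, such a product evaluates at s = 0 to 0 times the value of [W] at its
    pole, which is not its limit. Hence expansions are compared for 0 < h < d only, and the identity
    theorem concludes on punctured neighbourhoods.

    The tail is a double series in [x] and [l]. The norm of a power series is the sum of the
    absolute values of its terms at a fixed radius: it is submultiplicative, and summability of the
    norms gives analyticity of the sum. *)

Ltac field_R := match goal with |- ?a = ?b => change (@eq R a b); field end.

(** * Absolutely convergent power series *)

Lemma is_series_bounded_pos (b : nat -> R) (M : R) :
  (forall j, 0 <= b j) -> (forall N, sum_f_R0 b N <= M) ->
  ex_series b /\ Series b <= M.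
Proof.
intros Hb HM.
assert (E : ex_finite_lim_seq (sum_n b)).
{ apply (ex_finite_lim_seq_incr _ M).
  - intro N. rewrite sum_Sn. unfold plus; simpl. specialize (Hb (S N)); lra.
  - intro N. rewrite sum_n_Reals. apply HM. }
destruct E as [l Hl]. split; [exists l; exact Hl|].
rewrite (is_series_unique b l Hl).
apply (is_lim_seq_le (sum_n b) (fun _ => M) (Finite l) (Finite M)).
- intro N. rewrite sum_n_Reals. apply HM.
- exact Hl.
- apply is_lim_seq_const.
Qed.

Lemma sum_le_Series (b : nat -> R) (N : nat) :
  (forall j, 0 <= b j) -> ex_series b -> sum_f_R0 b N <= Series b.
Proof.
intros Hb [l Hl]. rewrite (is_series_unique b l Hl).
rewrite <- sum_n_Reals.
apply (is_lim_seq_incr_compare (sum_n b) l Hl).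
intro k. rewrite sum_Sn. unfold plus; simpl. specialize (Hb (S k)); lra.
Qed.

Lemma is_series_le_abs (b c : nat -> R) (l : R) (M : R) :
  (forall j, Rabs (c j) <= b j) -> (forall N, sum_f_R0 b N <= M) ->
  is_series c l -> Rabs l <= M.
Proof.
intros Hb HM Hl.
apply (is_lim_seq_le (fun N => Rabs (sum_n c N)) (fun _ => M)
         (Finite (Rabs l)) (Finite M)).
- intro N. rewrite sum_n_Reals.
  eapply Rle_trans; [apply Rsum_abs|].
  eapply Rle_trans; [|apply (HM N)].
  apply sum_Rle. intros k _. apply Hb.
- apply (is_lim_seq_abs (sum_n c) (Finite l)). exact Hl.
- apply is_lim_seq_const.
Qed.

Lemma ex_series_bounded (b c : nat -> R) (M : R) :
  (forall j, Rabs (c j) <= b j) -> (forall N, sum_f_R0 b N <= M) ->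
  ex_series c.
Proof.
intros Hb HM.
apply (ex_series_le (K := R_AbsRing) (V := R_CompleteNormedModule) c b Hb).
apply (is_series_bounded_pos b M).
- intro j. eapply Rle_trans; [apply Rabs_pos|apply Hb].
- exact HM.
Qed.

(* The radius [rho] and the bound [M] on the norm of the coefficients are
   explicit so that countable sums of such functions can be controlled. *)
Definition wiener (rho M : R) (f : R -> R) : Prop :=
  exists a : nat -> R,
    (forall N, sum_f_R0 (fun j => Rabs (a j) * rho ^ j) N <= M) /\
    (forall h, Rabs h <= rho -> is_series (fun j => a j * h ^ j) (f h)).

Lemma pow_abs_le (rho h c : R) (j : nat) :
  Rabs h <= rho -> Rabs (c * h ^ j) <= Rabs c * rho ^ j.
Proof.
intro H. rewrite Rabs_mult, <- RPow_abs.
apply Rmult_le_compat_l; [apply Rabs_pos|].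
apply pow_incr. split; [apply Rabs_pos|exact H].
Qed.

Lemma wiener_bound rho M f h :
  wiener rho M f -> Rabs h <= rho -> Rabs (f h) <= M.
Proof.
intros [a [Ha Hs]] Hh.
refine (is_series_le_abs _ _ _ M _ Ha (Hs h Hh)).
intro j. now apply pow_abs_le.
Qed.

Lemma wiener_nonneg rho M f : 0 <= rho -> wiener rho M f -> 0 <= M.
Proof.
intros Hr H. eapply Rle_trans; [apply Rabs_pos|].
apply (wiener_bound rho M f 0 H). rewrite Rabs_R0. exact Hr.
Qed.

Lemma wiener_ext rho M f g :
  (forall h, Rabs h <= rho -> f h = g h) -> wiener rho M f -> wiener rho M g.
Proof.
intros E [a [Ha Hs]]. exists a; split; [exact Ha|].
intros h Hh. rewrite <- (E h Hh). now apply Hs.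
Qed.

Lemma wiener_le rho rho' M M' f :
  0 <= rho' <= rho -> M <= M' -> wiener rho M f -> wiener rho' M' f.
Proof.
intros [H0 Hr] HM [a [Ha Hs]]. exists a; split.
- intro N. eapply Rle_trans; [|exact HM].
  eapply Rle_trans; [|apply (Ha N)].
  apply sum_Rle. intros j _. apply Rmult_le_compat_l; [apply Rabs_pos|].
  now apply pow_incr.
- intros h Hh. apply Hs. lra.
Qed.

Lemma wiener_plus rho M M' f g : 0 <= rho ->
  wiener rho M f -> wiener rho M' g -> wiener rho (M + M') (fun h => f h + g h).
Proof.
intros Hr [a [Ha Hs]] [b [Hb Ht]]. exists (fun j => a j + b j); split.
- intro N.
  eapply Rle_trans; [|apply (Rplus_le_compat _ _ _ _ (Ha N) (Hb N))].
  rewrite <- plus_sum. apply sum_Rle. intros j _.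
  rewrite <- Rmult_plus_distr_r. apply Rmult_le_compat_r; [now apply pow_le|].
  apply Rabs_triang.
- intros h Hh.
  eapply is_series_ext; [|exact (is_series_plus _ _ _ _ (Hs h Hh) (Ht h Hh))].
  intro j. unfold plus; simpl. ring_R.
Qed.

Lemma wiener_scal rho M c f :
  wiener rho M f -> wiener rho (Rabs c * M) (fun h => c * f h).
Proof.
intros [a [Ha Hs]]. exists (fun j => c * a j); split.
- intro N. rewrite (sum_eq _ (fun j => (Rabs (a j) * rho ^ j) * Rabs c)).
  + rewrite <- scal_sum. apply Rmult_le_compat_l; [apply Rabs_pos|apply Ha].
  + intros j _. rewrite Rabs_mult. ring.
- intros h Hh.
  eapply is_series_ext; [|exact (is_series_scal c _ _ (Hs h Hh))].
  intro j. unfold scal; simpl. unfold mult; simpl. ring_R.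
Qed.

Lemma is_series_finite (c : nat -> R) (N : nat) :
  (forall j, (N < j)%nat -> c j = 0) -> is_series c (sum_f_R0 c N).
Proof.
intro H. apply is_series_Reals. intros eps He. exists N. intros m Hm.
replace (sum_f_R0 c m) with (sum_f_R0 c N).
- unfold Rdist. rewrite Rminus_diag, Rabs_R0. exact He.
- induction Hm as [|m Hm IH]; [reflexivity|].
  rewrite tech5, <- IH, (H (S m)) by lia. ring.
Qed.

Lemma wiener_affine rho c d : 0 <= rho ->
  wiener rho (Rabs c + Rabs d * rho) (fun h => c + d * h).
Proof.
intro Hr. exists (fun j => match j with 0%nat => c | 1%nat => d | _ => 0 end).
assert (Z : forall j, (1 < j)%nat ->
  match j with 0%nat => c | 1%nat => d | _ => 0 end = 0)
  by (intros [|[|j]] Hj; [lia|lia|reflexivity]).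
split.
- intros [|N]; [simpl; rewrite Rmult_1_r;
    pose proof (Rabs_pos d); nra|].
  assert (Hd := is_series_finite (fun j => Rabs match j with 0%nat => c | 1%nat => d | _ => 0 end * rho ^ j) 1).
  simpl in Hd.
  apply Rle_trans with (Rabs c * 1 + Rabs d * (rho * 1)); [|lra].
  induction N as [|N IH]; [simpl; lra|].
  rewrite tech5. rewrite (Rabs_R0). lra.
- intros h _. simpl.
  replace (c + d * h) with (sum_f_R0 (fun j =>
    match j with 0%nat => c | 1%nat => d | _ => 0 end * h ^ j) 1)
    by (simpl; ring).
  apply is_series_finite. intros j Hj. rewrite Z by lia. ring.
Qed.

Lemma wiener_const rho c : 0 <= rho -> wiener rho (Rabs c) (fun _ => c).
Proof.
intro Hr.
apply (wiener_ext _ _ (fun h => c + 0 * h)); [intros; ring|].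
eapply wiener_le; [| |apply (wiener_affine rho c 0 Hr)]; [lra|].
rewrite Rabs_R0; lra.
Qed.

(** The norm is submultiplicative: the Cauchy product of the two series of absolute values dominates
    the series of [PS_mult a b], and its sum is the product of the norms. *)
Lemma wiener_mult rho M M' f g : 0 <= rho ->
  wiener rho M f -> wiener rho M' g -> wiener rho (M * M') (fun h => f h * g h).
Proof.
intros Hr Hf Hg.
assert (HM := wiener_nonneg _ _ _ Hr Hf). assert (HM' := wiener_nonneg _ _ _ Hr Hg).
destruct Hf as [a [Ha Hs]], Hg as [b [Hb Ht]].
assert (Pa : forall j, 0 <= Rabs (a j) * rho ^ j)
  by (intro; apply Rmult_le_pos; [apply Rabs_pos|now apply pow_le]).
assert (Pb : forall j, 0 <= Rabs (b j) * rho ^ j)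
  by (intro; apply Rmult_le_pos; [apply Rabs_pos|now apply pow_le]).
destruct (is_series_bounded_pos _ M Pa Ha) as [Ea La].
destruct (is_series_bounded_pos _ M' Pb Hb) as [Eb Lb].
exists (PS_mult a b); split.
- intro N.
  assert (H := is_series_mult_pos _ _ _ _ (Series_correct _ Ea)
                 (Series_correct _ Eb) Pa Pb).
  set (c := fun n => sum_f_R0 (fun k => Rabs (a k) * rho ^ k *
              (Rabs (b (n - k)%nat) * rho ^ (n - k))) n) in H.
  assert (Pc : forall n, 0 <= c n).
  { intro n. apply cond_pos_sum. intro k. apply Rmult_le_pos; [apply Pa|apply Pb]. }
  apply Rle_trans with (sum_f_R0 c N).
  + apply sum_Rle. intros n _. unfold PS_mult, c.
    rewrite Rmult_comm.
    eapply Rle_trans;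
      [apply Rmult_le_compat_l; [now apply pow_le|apply Rsum_abs]|].
    rewrite scal_sum. apply sum_Rle. intros k Hk.
    rewrite Rabs_mult. apply Req_le.
    replace (rho ^ n) with (rho ^ k * rho ^ (n - k))
      by (rewrite <- pow_add; f_equal; lia). ring.
  + eapply Rle_trans; [apply sum_le_Series; [exact Pc|eexists; exact H]|].
    rewrite (is_series_unique _ _ H).
    apply Rmult_le_compat; trivial.
    * eapply Rle_trans; [apply (Pa 0%nat)|]. exact (sum_le_Series _ 0 Pa Ea).
    * eapply Rle_trans; [apply (Pb 0%nat)|]. exact (sum_le_Series _ 0 Pb Eb).
- intros h Hh.
  assert (H : is_series (fun n => sum_f_R0 (fun k => (a k * h ^ k) *
              (b (n - k)%nat * h ^ (n - k))) n) (f h * g h)).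
  { apply (is_series_mult (fun k => a k * h ^ k) (fun k => b k * h ^ k)); [now apply Hs|now apply Ht| |].
    - apply (ex_series_bounded (fun j => Rabs (a j) * rho ^ j) _ M); [|exact Ha].
      intro j. rewrite Rabs_Rabsolu. now apply pow_abs_le.
    - apply (ex_series_bounded (fun j => Rabs (b j) * rho ^ j) _ M'); [|exact Hb].
      intro j. rewrite Rabs_Rabsolu. now apply pow_abs_le. }
  eapply is_series_ext; [|exact H]. intro n. unfold PS_mult. simpl.
  rewrite Rmult_comm, scal_sum. apply sum_eq. intros k Hk.
  replace (h ^ n) with (h ^ k * h ^ (n - k))
    by (rewrite <- pow_add; f_equal; lia). ring.
Qed.

Lemma wiener_dilate rho rho' M c f : 0 <= rho' -> Rabs c * rho' <= rho ->
  wiener rho M f -> wiener rho' M (fun h => f (c * h)).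
Proof.
intros Hr Hc [a [Ha Hs]]. exists (fun j => a j * c ^ j); split.
- intro N. eapply Rle_trans; [|apply (Ha N)]. apply sum_Rle. intros j _.
  rewrite Rabs_mult, Rmult_assoc. apply Rmult_le_compat_l; [apply Rabs_pos|].
  rewrite <- RPow_abs, <- Rpow_mult_distr. apply pow_incr. split; [|exact Hc].
  apply Rmult_le_pos; [apply Rabs_pos|exact Hr].
- intros h Hh. eapply is_series_ext; [|apply (Hs (c * h))].
  + intro j. cbv beta. rewrite Rpow_mult_distr. ring_R.
  + rewrite Rabs_mult. eapply Rle_trans; [|exact Hc].
    apply Rmult_le_compat_l; [apply Rabs_pos|exact Hh].
Qed.

Lemma wiener_exp rho al be : 0 <= rho ->
  wiener rho (exp (be + Rabs al * rho)) (fun h => exp (be + al * h)).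
Proof.
intro Hr.
assert (H : forall x, is_series (fun j => / INR (fact j) * x ^ j) (exp x))
  by (intro x; apply is_pseries_R, is_exp_Reals).
assert (F : forall j, 0 < / INR (fact j))
  by (intro; apply Rinv_0_lt_compat, INR_fact_lt_0).
exists (fun j => exp be * (/ INR (fact j) * al ^ j)); split.
- intro N. rewrite exp_plus.
  rewrite (sum_eq _ (fun j => / INR (fact j) * (Rabs al * rho) ^ j * exp be)).
  + rewrite <- scal_sum. apply Rmult_le_compat_l; [left; apply exp_pos|].
    rewrite <- (is_series_unique _ _ (H (Rabs al * rho))).
    apply sum_le_Series; [|eexists; apply H].
    intro j. apply Rmult_le_pos; [left; apply F|].
    apply pow_le, Rmult_le_pos; [apply Rabs_pos|exact Hr].
  + intros j _. rewrite !Rabs_mult, <- RPow_abs, Rpow_mult_distr.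
    rewrite (Rabs_pos_eq (exp be)) by (left; apply exp_pos).
    rewrite (Rabs_pos_eq (/ _)) by (left; apply F). ring.
- intros h _. rewrite exp_plus.
  eapply is_series_ext; [|exact (is_series_scal (exp be) _ _ (H (al * h)))].
  intro j. unfold scal; simpl. unfold mult; simpl. rewrite Rpow_mult_distr. ring_R.
Qed.

(** Dropping [a 0] and shifting the coefficients divides the norm by [rho]. The explicit factor
    matters when the division by [h] is iterated, for accumulating zeros as well as for second-order
    remainders. *)
Lemma wiener_step rho M f : 0 < rho -> wiener rho M f ->
  exists q, wiener rho (M / rho) q /\
    forall h, Rabs h <= rho -> f h = f 0 + h * q h.
Proof.
intros Hr [a [Ha Hs]].
assert (H0 : f 0 = a 0%nat).
{ assert (E := is_series_finite (fun j => a j * 0 ^ j) 0).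
  simpl in E. rewrite Rmult_1_r in E.
  assert (E' := Hs 0). rewrite Rabs_R0 in E'.
  rewrite <- (is_series_unique _ _ (E' (Rlt_le _ _ Hr))). apply is_series_unique.
  apply E. intros [|j] Hj; [lia|]. simpl. ring. }
set (b := fun j => a (S j)).
assert (B : forall N, sum_f_R0 (fun j => Rabs (b j) * rho ^ j) N <= M / rho).
{ intro N. apply (Rmult_le_reg_r rho); [exact Hr|].
  replace (M / rho * rho) with M by (field; lra).
  eapply Rle_trans; [|apply (Ha (S N))].
  rewrite (decomp_sum _ (S N)) by lia. simpl Init.Nat.pred.
  rewrite Rmult_comm, scal_sum.
  rewrite (sum_eq (fun i => Rabs (b i) * rho ^ i * rho)
             (fun i => Rabs (a (S i)) * rho ^ S i))
    by (intros; unfold b; simpl; ring).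
  pose proof (Rabs_pos (a 0%nat)). simpl. lra. }
exists (fun h => Series (fun j => b j * h ^ j)). split.
- exists b; split; [exact B|]. intros h Hh. apply Series_correct.
  apply (ex_series_bounded (fun j => Rabs (b j) * rho ^ j) _ (M / rho)); [|exact B].
  intro j. now apply pow_abs_le.
- intros h Hh. rewrite H0. symmetry.
  rewrite <- (is_series_unique _ _ (Hs h Hh)), (Series_incr_1 (fun j => a j * h ^ j))
    by (eexists; now apply Hs).
  rewrite <- Series_scal_l. simpl. rewrite Rmult_1_r. f_equal.
  apply Series_ext. intro j. unfold b. simpl. ring.
Qed.

(** Tannery's theorem: a finite head converges term by term, and the rest is at most twice the tail
    of [M]. *)
Lemma dominated_series (b : nat -> nat -> R) (c M : nat -> R) :
  (forall k N, Rabs (b k N) <= M k) -> ex_series M ->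
  (forall k, is_lim_seq (b k) (c k)) ->
  is_lim_seq (fun N => Series (fun k => b k N)) (Series c).
Proof.
intros Hb HM Hc.
assert (Hcm : forall k, Rabs (c k) <= M k).
{ intro k. apply (is_lim_seq_le (fun N => Rabs (b k N)) (fun _ => M k)
    (Finite (Rabs (c k))) (Finite (M k))).
  - intro N; apply Hb.
  - apply (is_lim_seq_abs (b k) (Finite (c k))), Hc.
  - apply is_lim_seq_const. }
assert (Pm : forall k, 0 <= M k)
  by (intro k; eapply Rle_trans; [apply Rabs_pos|apply (Hcm k)]).
assert (X : forall u : nat -> R, (forall k, Rabs (u k) <= M k) -> ex_series u)
  by (intros u Hu; exact (ex_series_le (K := R_AbsRing) (V := R_CompleteNormedModule) u M Hu HM)).
apply is_lim_seq_spec. intro eps.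
(* One quarter goes to the head and two quarters to the tail, where [b] and [c] are each dominated
   by [M]. *)
assert (He : 0 < eps / 4) by (destruct eps; simpl; lra).
destruct HM as [S HS]. change R in (type of S).
assert (HS' : is_lim_seq (sum_n M) S) by exact HS. apply is_lim_seq_spec in HS'.
destruct (HS' (mkposreal _ He)) as [K HK].
specialize (HK K (le_n K)). simpl in HK. rewrite sum_n_Reals in HK.
assert (HF : is_lim_seq (fun N => sum_n (fun k => b k N - c k) K) 0).
{ clear HK. induction K as [|K IH].
  - apply (is_lim_seq_ext (fun N => b 0%nat N - c 0%nat)).
    + intro N. now rewrite sum_O.
    + replace (Finite 0) with (Finite (c 0%nat - c 0%nat)) by (f_equal; ring).
      apply is_lim_seq_minus'; [apply Hc|apply is_lim_seq_const].
  - apply (is_lim_seq_ext (fun N => sum_n (fun k => b k N - c k) K + (b (Datatypes.S K) N - c (Datatypes.S K)))).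
    + intro N. now rewrite sum_Sn.
    + replace (Finite 0) with (Finite (0 + (c (Datatypes.S K) - c (Datatypes.S K)))) by (f_equal; ring).
      apply is_lim_seq_plus'; [exact IH|].
      apply is_lim_seq_minus'; [apply Hc|apply is_lim_seq_const]. }
apply is_lim_seq_spec in HF.
destruct (HF (mkposreal _ He)) as [N0 HN0].
exists N0. intros N HN. specialize (HN0 N HN). simpl in HN0.
rewrite Rminus_0_r, sum_n_Reals in HN0.
rewrite <- Series_minus by (apply X; auto).
assert (Ed : ex_series (fun k => b k N - c k)).
{ apply (ex_series_minus (K := R_AbsRing) (V := R_NormedModule) (fun k => b k N) c); apply X; auto. }
rewrite (Series_incr_n _ (Datatypes.S K)) by (auto; lia). simpl Init.Nat.pred.
assert (T : Rabs (Series (fun k => b (Datatypes.S K + k)%nat N - c (Datatypes.S K + k)%nat)) <= 2 * (S - sum_f_R0 M K)).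
{ assert (E : is_series (fun k => M (Datatypes.S K + k)%nat) (S - sum_f_R0 M K)).
  { apply (is_series_incr_n (K := R_AbsRing) (V := R_NormedModule) M (Datatypes.S K)); [lia|].
    simpl Init.Nat.pred. rewrite sum_n_Reals.
    refine (eq_ind _ (is_series M) HS _ _). unfold plus; simpl. ring_R. }
  assert (E2 : is_series (fun k => 2 * M (Datatypes.S K + k)%nat) (2 * (S - sum_f_R0 M K)))
    by exact (is_series_scal_l 2 _ _ E).
  clear E; rename E2 into E.
  eapply Rle_trans.
  - apply Series_Rabs. apply (ex_series_bounded (fun k => 2 * M (Datatypes.S K + k)%nat) _ (2 * (S - sum_f_R0 M K))).
    + intro j. rewrite Rabs_Rabsolu. unfold Rminus. eapply Rle_trans; [apply Rabs_triang|].
      rewrite Rabs_Ropp. specialize (Hb (Datatypes.S K + j)%nat N). specialize (Hcm (Datatypes.S K + j)%nat). lra.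
    + intro n. eapply Rle_trans; [apply sum_le_Series|].
      * intro j. specialize (Pm (Datatypes.S K + j)%nat). lra.
      * eexists; exact E.
      * right. apply (is_series_unique _ _ E).
  - rewrite <- (is_series_unique _ _ E). apply Series_le; [|eexists; exact E].
    intro j. split; [apply Rabs_pos|]. unfold Rminus. eapply Rle_trans; [apply Rabs_triang|].
    rewrite Rabs_Ropp. specialize (Hb (Datatypes.S K + j)%nat N). specialize (Hcm (Datatypes.S K + j)%nat).
    lra. }
assert (T2 : S - sum_f_R0 M K < eps / 4).
{ apply Rabs_def2 in HK. lra. }
eapply Rle_lt_trans; [apply Rabs_triang|]. destruct eps as [e e0]; simpl in *. lra.
Qed.

(** The double series of the [a k j * h ^ j] is summed in the other order. For every cutoff [N] the
    partial sum over [j] is bounded by [M k], so dominated convergence in [k] applies. *)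
Lemma wiener_sum rho (M : nat -> R) (F : nat -> R -> R) : 0 < rho ->
  (forall k, wiener rho (M k) (F k)) -> ex_series M ->
  wiener rho (Series M) (fun h => Series (fun k => F k h)).
Proof.
intros Hr HF HM.
destruct (functional_choice _ HF) as [a Ha].
assert (P : forall k j, 0 <= Rabs (a k j) * rho ^ j)
  by (intros; apply Rmult_le_pos; [apply Rabs_pos|apply pow_le; lra]).
assert (B : forall k j, Rabs (a k j) * rho ^ j <= M k).
{ intros k j. eapply Rle_trans; [|apply (proj1 (Ha k) j)].
  destruct j as [|j]; [simpl; lra|]. rewrite tech5.
  pose proof (cond_pos_sum _ j (P k)). lra. }
assert (Ej : forall j, ex_series (fun k => Rabs (a k j))).
{ intro j. apply (ex_series_ext (fun k => / rho ^ j * (Rabs (a k j) * rho ^ j))).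
  - intro k. field_R. apply pow_nonzero; lra.
  - apply (ex_series_scal_l (/ rho ^ j) (fun k => Rabs (a k j) * rho ^ j)).
    apply (ex_series_le (K := R_AbsRing) (V := R_CompleteNormedModule) _ M); [|exact HM].
    intro k. unfold norm; simpl. unfold abs; simpl. rewrite Rabs_pos_eq by apply P. apply B. }
assert (Ej' : forall j, ex_series (fun k => a k j)) by (intro j; apply ex_series_Rabs, Ej).
(* Finite sums over [j] commute with the series over [k]; only the limit in [N] needs domination. *)
assert (Sw : forall (c : nat -> nat -> R) N, (forall j, ex_series (fun k => c k j)) ->
  ex_series (fun k => sum_f_R0 (c k) N) /\
  sum_f_R0 (fun j => Series (fun k => c k j)) N = Series (fun k => sum_f_R0 (c k) N)).
{ intros c N Ec. induction N as [|N [IH1 IH2]].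
  - split; [exact (Ec 0%nat)|reflexivity].
  - split.
    + exact (ex_series_plus (K := R_AbsRing) (V := R_NormedModule) _ _ IH1 (Ec (S N))).
    + simpl. rewrite IH2, <- Series_plus; trivial. }
exists (fun j => Series (fun k => a k j)). split.
- intro N.
  apply Rle_trans with (sum_f_R0 (fun j => Series (fun k => Rabs (a k j) * rho ^ j)) N).
  + apply sum_Rle. intros j _. rewrite Series_scal_r.
    apply Rmult_le_compat_r; [apply pow_le; lra|]. now apply Series_Rabs.
  + rewrite (proj2 (Sw (fun k j => Rabs (a k j) * rho ^ j) N
       (fun j => ex_series_scal_r (rho ^ j) _ (Ej j)))).
    apply Series_le; [|exact HM]. intro k. split.
    * apply cond_pos_sum. intro; apply P.
    * apply (proj1 (Ha k)).
- intros h Hh.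
  change (is_lim_seq (sum_n (fun j => Series (fun k => a k j) * h ^ j)) (Series (fun k => F k h))).
  apply (is_lim_seq_ext (fun N => Series (fun k => sum_f_R0 (fun j => a k j * h ^ j) N))).
  + intro N. rewrite sum_n_Reals.
    rewrite <- (proj2 (Sw (fun k j => a k j * h ^ j) N
       (fun j => ex_series_scal_r (h ^ j) _ (Ej' j)))).
    apply sum_eq. intros j _. apply Series_scal_r.
  + apply (dominated_series (fun k N => sum_f_R0 (fun j => a k j * h ^ j) N) _ M).
    * intros k N. eapply Rle_trans; [apply Rsum_abs|].
      eapply Rle_trans; [|apply (proj1 (Ha k) N)].
      apply sum_Rle. intros j _. now apply pow_abs_le.
    * exact HM.
    * intro k. apply (is_lim_seq_ext (sum_n (fun j => a k j * h ^ j))).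
      { intro N. apply sum_n_Reals. }
      apply (proj2 (Ha k) h Hh).
Qed.

Lemma eq_0_small (x C : R) :
  (forall d, 0 < d -> exists h, 0 < h < d /\ Rabs x <= C * h) -> x = 0.
Proof.
intro H. destruct (Req_dec x 0) as [|Hx]; [trivial|exfalso].
apply Rabs_pos_lt in Hx.
assert (HC : 0 < Rabs C + 1) by (pose proof (Rabs_pos C); lra).
destruct (H (Rabs x / (Rabs C + 1))) as [h [[h0 h1] Hh]].
- now apply Rdiv_lt_0_compat.
- apply Rlt_div_r in h1; [|exact HC].
  assert (C * h <= Rabs C * h) by (apply Rmult_le_compat_r; [lra|apply Rle_abs]). nra.
Qed.

(** Zeros accumulating at 0 kill the constant term, so that a factor [h] splits off and the quotient
    keeps these zeros. After [m] divisions the norm is at most [M / rho ^ m], whence |f h| <= M (|h|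
    / rho)^m, which tends to 0. *)
Lemma wiener_often_zero rho M f : 0 < rho -> wiener rho M f ->
  (forall d, 0 < d -> exists h, 0 < h < d /\ f h = 0) ->
  forall h, Rabs h < rho -> f h = 0.
Proof.
intros Hr Hf Hz.
assert (Q : forall m, exists q, wiener rho (M / rho ^ m) q /\
  (forall d, 0 < d -> exists h, 0 < h < d /\ q h = 0) /\
  forall h, Rabs h <= rho -> f h = h ^ m * q h).
{ induction m as [|m [q [Hq [Zq Eq]]]].
  - exists f. split; [|split; [exact Hz|intros; simpl; ring]].
    simpl. now rewrite Rdiv_1_r.
  - destruct (wiener_step _ _ _ Hr Hq) as [r [Wr Er]].
    assert (Q0 : q 0 = 0).
    { apply (eq_0_small _ (M / rho ^ m / rho)). intros d Hd.
      destruct (Zq (Rmin d rho)) as [h [[h0 h1] Hh]]; [now apply Rmin_glb_lt|].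
      apply Rmin_Rgt in h1. destruct h1 as [h1 h2]. exists h. split; [lra|].
      assert (Hh' : Rabs h <= rho) by (rewrite Rabs_pos_eq; lra).
      assert (B := wiener_bound _ _ _ h Wr Hh').
      rewrite (Er h Hh') in Hh. replace (q 0) with (- (h * r h)) by lra.
      rewrite Rabs_Ropp, Rabs_mult, (Rabs_pos_eq h) by lra. nra. }
    exists r. split; [|split].
    + replace (M / rho ^ S m) with (M / rho ^ m / rho); [exact Wr|].
      assert (rho ^ m <> 0) by (apply pow_nonzero; lra). simpl. field. lra.
    + intros d Hd. destruct (Zq (Rmin d rho)) as [h [[h0 h1] Hh]]; [now apply Rmin_glb_lt|].
      apply Rmin_Rgt in h1. exists h. split; [lra|].
      rewrite Er, Q0 in Hh by (rewrite Rabs_pos_eq; lra).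
      rewrite Rplus_0_l in Hh. apply Rmult_integral in Hh. lra.
    + intros h Hh. rewrite Eq, Er, Q0 by exact Hh. simpl. ring. }
intros h Hh. apply Rabs_eq_0. apply Rle_antisym; [|apply Rabs_pos].
apply (is_lim_seq_le (fun _ => Rabs (f h)) (fun m => M * (Rabs h / rho) ^ m)
   (Finite (Rabs (f h))) (Finite 0)).
- intro m. destruct (Q m) as [q [Wq [_ Eq]]].
  rewrite Eq by lra. rewrite Rabs_mult, <- RPow_abs.
  assert (B := wiener_bound _ _ _ h Wq (Rlt_le _ _ Hh)).
  unfold Rdiv. rewrite Rpow_mult_distr, pow_inv.
  replace (M * (Rabs h ^ m * / rho ^ m)) with (Rabs h ^ m * (M / rho ^ m))
    by (unfold Rdiv; ring).
  apply Rmult_le_compat_l; [apply pow_le, Rabs_pos|exact B].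
- apply is_lim_seq_const.
- replace (Finite 0) with (Rbar_mult M 0) by (simpl; f_equal; ring).
  apply is_lim_seq_scal_l, is_lim_seq_geom.
  rewrite Rabs_div, Rabs_Rabsolu, (Rabs_pos_eq rho) by lra.
  apply Rlt_div_l; lra.
Qed.

(** * First-order expansions *)

(* First-order expansion at [0+], with a quadratic error term. *)
Definition jet (f : R -> R) (c0 c1 : R) : Prop :=
  exists C d, 0 < d /\ forall h, 0 < h < d -> Rabs (f h - c0 - c1 * h) <= C * h ^ 2.

Lemma jet_unique f c0 c1 d0 d1 : jet f c0 c1 -> jet f d0 d1 -> c0 = d0 /\ c1 = d1.
Proof.
intros [C [d [Hd HC]]] [C' [d' [Hd' HC']]].
assert (E : forall h, 0 < h -> h < d -> h < d' -> Rabs ((c0 - d0) + (c1 - d1) * h) <= (C + C') * h ^ 2).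
{ intros h h0 h1 h2. replace (c0 - d0 + (c1 - d1) * h)
    with ((f h - d0 - d1 * h) + - (f h - c0 - c1 * h)) by ring.
  eapply Rle_trans; [apply Rabs_triang|]. rewrite Rabs_Ropp.
  specialize (HC h (conj h0 h1)). specialize (HC' h (conj h0 h2)). lra. }
assert (E0 : c0 - d0 = 0).
{ apply (eq_0_small _ (Rabs (C + C') + Rabs (c1 - d1))). intros e He.
  set (m := Rmin (Rmin e 1) (Rmin d d')).
  assert (Hm : 0 < m) by (repeat apply Rmin_glb_lt; lra).
  assert (M1 : m <= e) by (unfold m; eapply Rle_trans; [apply Rmin_l|apply Rmin_l]).
  assert (M2 : m <= 1) by (unfold m; eapply Rle_trans; [apply Rmin_l|apply Rmin_r]).
  assert (M3 : m <= d) by (unfold m; eapply Rle_trans; [apply Rmin_r|apply Rmin_l]).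
  assert (M4 : m <= d') by (unfold m; eapply Rle_trans; [apply Rmin_r|apply Rmin_r]).
  exists (m / 2). split; [lra|]. set (h := m / 2) in *.
  assert (h0 : 0 < h < 1) by (unfold h; lra).
  assert (F := E h ltac:(lra) ltac:(unfold h; lra) ltac:(unfold h; lra)).
  replace (c0 - d0) with ((c0 - d0 + (c1 - d1) * h) + - ((c1 - d1) * h)) by ring.
  eapply Rle_trans; [apply Rabs_triang|].
  rewrite Rabs_Ropp, Rabs_mult, (Rabs_pos_eq h) by lra.
  pose proof (Rle_abs (C + C')). pose proof (Rabs_pos (C + C')).
  assert ((C + C') * h ^ 2 <= Rabs (C + C') * h ^ 2) by (apply Rmult_le_compat_r; nra).
  assert (Rabs (C + C') * h ^ 2 <= Rabs (C + C') * h) by (apply Rmult_le_compat_l; nra).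
  lra. }
split; [lra|]. rewrite E0 in E.
enough (c1 - d1 = 0) by lra.
apply (eq_0_small _ (C + C')). intros e He.
set (m := Rmin e (Rmin d d')).
assert (Hm : 0 < m) by (repeat apply Rmin_glb_lt; lra).
assert (M1 : m <= e) by (unfold m; apply Rmin_l).
assert (M3 : m <= d) by (unfold m; eapply Rle_trans; [apply Rmin_r|apply Rmin_l]).
assert (M4 : m <= d') by (unfold m; eapply Rle_trans; [apply Rmin_r|apply Rmin_r]).
exists (m / 2). split; [lra|]. set (h := m / 2) in *.
assert (F := E h ltac:(unfold h; lra) ltac:(unfold h; lra) ltac:(unfold h; lra)).
rewrite Rplus_0_l, Rabs_mult, (Rabs_pos_eq h) in F by (unfold h; lra).
assert (0 < h) by (unfold h; lra).
apply (Rmult_le_reg_r h); [lra|]. nra.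
Qed.

Lemma jet_plus f g c0 c1 d0 d1 :
  jet f c0 c1 -> jet g d0 d1 -> jet (fun h => f h + g h) (c0 + d0) (c1 + d1).
Proof.
intros [C [d [Hd HC]]] [C' [d' [Hd' HC']]].
exists (C + C'), (Rmin d d'). split; [now apply Rmin_glb_lt|].
intros h [h0 h1]. apply Rmin_Rgt in h1. destruct h1 as [h1 h2].
specialize (HC h (conj h0 h1)). specialize (HC' h (conj h0 h2)).
replace (f h + g h - (c0 + d0) - (c1 + d1) * h)
  with ((f h - c0 - c1 * h) + (g h - d0 - d1 * h)) by ring.
eapply Rle_trans; [apply Rabs_triang|]. lra.
Qed.

Lemma jet_const c : jet (fun _ => c) c 0.
Proof.
exists 0, 1. split; [lra|]. intros h _.
replace (c - c - 0 * h) with 0 by ring. rewrite Rabs_R0. lra.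
Qed.

Lemma jet_affine c d : jet (fun h => c + d * h) c d.
Proof.
exists 0, 1. split; [lra|]. intros h _.
replace (c + d * h - c - d * h) with 0 by ring. rewrite Rabs_R0. lra.
Qed.

Lemma jet_scal c f c0 c1 : jet f c0 c1 -> jet (fun h => c * f h) (c * c0) (c * c1).
Proof.
intros [C [d [Hd HC]]]. exists (Rabs c * C), d. split; [exact Hd|].
intros h Hh. replace (c * f h - c * c0 - c * c1 * h) with (c * (f h - c0 - c1 * h)) by ring.
rewrite Rabs_mult, Rmult_assoc. apply Rmult_le_compat_l; [apply Rabs_pos|now apply HC].
Qed.

Lemma jet_mult f g c0 c1 d0 d1 : jet f c0 c1 -> jet g d0 d1 ->
  jet (fun h => f h * g h) (c0 * d0) (c0 * d1 + c1 * d0).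
Proof.
intros [C [d [Hd HC]]] [C' [d' [Hd' HC']]].
(* The three summands bound, in units of [h ^ 2], the product of the linear terms and the products
   with the errors [u] and [v]; taking [h < 1] bounds the cofactors by constants. *)
exists (Rabs (c1 * d1) + Rabs C * (Rabs d0 + Rabs d1 + Rabs C') + (Rabs c0 + Rabs c1) * Rabs C'), (Rmin 1 (Rmin d d')).
split; [repeat apply Rmin_glb_lt; lra|].
intros h [h0 h1]. apply Rmin_Rgt in h1. destruct h1 as [h1 h2].
apply Rmin_Rgt in h2. destruct h2 as [h2 h3].
specialize (HC h (conj h0 h2)). specialize (HC' h (conj h0 h3)).
set (u := f h - c0 - c1 * h) in *. set (v := g h - d0 - d1 * h) in *.
replace (f h) with (u + c0 + c1 * h) by (unfold u; ring).
replace (g h) with (v + d0 + d1 * h) by (unfold v; ring).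
replace ((u + c0 + c1 * h) * (v + d0 + d1 * h) - c0 * d0 - (c0 * d1 + c1 * d0) * h)
  with (c1 * d1 * h ^ 2 + u * (d0 + d1 * h + v) + (c0 + c1 * h) * v) by ring.
assert (Hu : Rabs u <= Rabs C * h ^ 2) by (pose proof (Rle_abs C); nra).
assert (Hv : Rabs v <= Rabs C' * h ^ 2) by (pose proof (Rle_abs C'); nra).
assert (h2' : 0 <= h ^ 2 <= 1) by nra.
assert (Hv1 : Rabs v <= Rabs C') by (pose proof (Rabs_pos C'); nra).
assert (A1 : Rabs (d0 + d1 * h + v) <= Rabs d0 + Rabs d1 + Rabs C').
{ eapply Rle_trans; [apply Rabs_triang|]. apply Rplus_le_compat; [|exact Hv1].
  eapply Rle_trans; [apply Rabs_triang|]. apply Rplus_le_compat_l.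
  rewrite Rabs_mult, (Rabs_pos_eq h) by lra. pose proof (Rabs_pos d1). nra. }
assert (A2 : Rabs (c0 + c1 * h) <= Rabs c0 + Rabs c1).
{ eapply Rle_trans; [apply Rabs_triang|]. apply Rplus_le_compat_l.
  rewrite Rabs_mult, (Rabs_pos_eq h) by lra. pose proof (Rabs_pos c1). nra. }
assert (B0 : Rabs (c1 * d1 * h ^ 2) = Rabs (c1 * d1) * h ^ 2)
  by (rewrite Rabs_mult, (Rabs_pos_eq (h ^ 2)) by lra; reflexivity).
assert (B1 := Rmult_le_compat _ _ _ _ (Rabs_pos _) (Rabs_pos _) Hu A1).
assert (B2 := Rmult_le_compat _ _ _ _ (Rabs_pos _) (Rabs_pos _) A2 Hv).
rewrite <- Rabs_mult in B1, B2.
eapply Rle_trans; [apply Rabs_triang|].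
eapply Rle_trans; [apply Rplus_le_compat_r, Rabs_triang|]. lra.
Qed.

Lemma jet_dilate f c c0 c1 : 0 < c -> jet f c0 c1 -> jet (fun h => f (c * h)) c0 (c * c1).
Proof.
intros Hc [C [d [Hd HC]]]. exists (C * c ^ 2), (d / c). split; [now apply Rdiv_lt_0_compat|].
intros h [h0 h1]. apply Rlt_div_r in h1; [|exact Hc].
specialize (HC (c * h) ltac:(nra)).
replace (c * c1 * h) with (c1 * (c * h)) by ring.
eapply Rle_trans; [exact HC|]. right; ring.
Qed.

Lemma jet_ext f g c0 c1 d : 0 < d -> (forall h, 0 < h < d -> f h = g h) ->
  jet f c0 c1 -> jet g c0 c1.
Proof.
intros Hd E [C [d' [Hd' HC]]]. exists C, (Rmin d d'). split; [now apply Rmin_glb_lt|].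
intros h [h0 h1]. apply Rmin_Rgt in h1. rewrite <- E by lra. apply HC; lra.
Qed.

Lemma wiener_expand rho M f : 0 < rho -> wiener rho M f ->
  exists c r, wiener rho (M / rho / rho) r /\ jet f (f 0) c /\
    forall h, Rabs h <= rho -> f h = f 0 + c * h + h ^ 2 * r h.
Proof.
intros Hr Hf.
destruct (wiener_step _ _ _ Hr Hf) as [q [Hq Eq]].
destruct (wiener_step _ _ _ Hr Hq) as [r [Wr Er]].
assert (E : forall h, Rabs h <= rho -> f h = f 0 + q 0 * h + h ^ 2 * r h).
{ intros h Hh. rewrite (Eq h Hh) at 1. rewrite (Er h Hh). ring. }
exists (q 0), r. split; [exact Wr|]. split; [|exact E].
exists (M / rho / rho), rho. split; [exact Hr|]. intros h Hh.
assert (Hh' : Rabs h <= rho) by (rewrite Rabs_pos_eq; lra).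
rewrite (E h Hh').
replace (f 0 + q 0 * h + h ^ 2 * r h - f 0 - q 0 * h) with (h ^ 2 * r h) by ring.
rewrite Rabs_mult, Rabs_pos_eq by nra. rewrite Rmult_comm.
apply Rmult_le_compat_r; [nra|]. now apply (wiener_bound _ _ _ h Wr).
Qed.

Lemma wiener_jet rho M f : 0 < rho -> wiener rho M f -> exists c, jet f (f 0) c.
Proof.
intros Hr Hf. destruct (wiener_expand _ _ _ Hr Hf) as [c [r [_ [J _]]]].
now exists c.
Qed.

(** The constant inside a [jet] is unspecified, so flatness alone would not survive an infinite sum.
    Uniqueness of the expansion turns it into a quadratic bound linear in the norm [M], which can be
    summed. *)
Lemma wiener_flat_bound rho M f : 0 < rho -> wiener rho M f -> jet f 0 0 ->
  forall h, Rabs h <= rho -> Rabs (f h) <= M / rho / rho * h ^ 2.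
Proof.
intros Hr Hf Hj. destruct (wiener_expand _ _ _ Hr Hf) as [c [r [Wr [J Er]]]].
destruct (jet_unique _ _ _ _ _ J Hj) as [E0 E1].
intros h Hh. rewrite (Er h Hh), E0, E1.
replace (0 + 0 * h + h ^ 2 * r h) with (h ^ 2 * r h) by ring.
rewrite Rabs_mult, (Rabs_pos_eq (h ^ 2)) by nra. rewrite Rmult_comm.
apply Rmult_le_compat_r; [nra|]. now apply (wiener_bound _ _ _ h Wr).
Qed.

Lemma jet_sum_flat rho (M : nat -> R) (F : nat -> R -> R) : 0 < rho ->
  (forall k, wiener rho (M k) (F k)) -> (forall k, jet (F k) 0 0) -> ex_series M ->
  jet (fun h => Series (fun k => F k h)) 0 0.
Proof.
intros Hr HF HJ HM. exists (Series M / rho / rho), rho. split; [exact Hr|].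
intros h Hh. assert (Hh' : Rabs h <= rho) by (rewrite Rabs_pos_eq; lra).
replace (Series (fun k => F k h) - 0 - 0 * h) with (Series (fun k => F k h)) by ring.
replace (Series M / rho / rho * h ^ 2) with (/ rho / rho * h ^ 2 * Series M) by (field; lra).
rewrite <- Series_scal_l.
assert (B : forall k, Rabs (F k h) <= / rho / rho * h ^ 2 * M k).
{ intro k. eapply Rle_trans; [apply (wiener_flat_bound _ _ _ Hr (HF k) (HJ k) h Hh')|].
  right. field. lra. }
assert (X : ex_series (fun k => / rho / rho * h ^ 2 * M k))
  by exact (ex_series_scal_l _ _ HM).
eapply Rle_trans; [apply Series_Rabs|].
- apply (ex_series_le (K := R_AbsRing) (V := R_CompleteNormedModule) _ (fun k => / rho / rho * h ^ 2 * M k)); [|exact X].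
  intro k. unfold norm; simpl. unfold abs; simpl. rewrite Rabs_Rabsolu. apply B.
- apply Series_le; [|exact X]. intro k; split; [apply Rabs_pos|apply B].
Qed.

(** * Analytic and meromorphic functions on the real axis *)

Definition ranalytic (u : R -> R) (t : R) : Prop :=
  exists rho M, 0 < rho /\ wiener rho M (fun h => u (t + h)).

(** The numerator [p] is a function of its own, tied to [u] only for [h <> 0], which leaves the
    value of [u] at a pole free. *)
Definition rmeromorphic (u : R -> R) (t : R) : Prop :=
  exists m p rho M, 0 < rho /\ wiener rho M p /\
    forall h, h <> 0 -> Rabs h <= rho -> p h = h ^ m * u (t + h).

Lemma ranalytic_rmeromorphic u t : ranalytic u t -> rmeromorphic u t.
Proof.
intros [rho [M [Hr W]]]. exists 0%nat, (fun h => u (t + h)), rho, M.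
split; [exact Hr|split; [exact W|]]. intros; simpl; ring.
Qed.

Lemma ranalytic_const c t : ranalytic (fun _ => c) t.
Proof.
exists 1, (Rabs c). split; [lra|]. apply wiener_const. lra.
Qed.

Lemma ranalytic_exp c d t : ranalytic (fun s => exp (c + d * s)) t.
Proof.
exists 1. eexists. split; [lra|].
apply (wiener_ext _ _ (fun h => exp ((c + d * t) + d * h))); [intros; f_equal; ring|].
apply wiener_exp. lra.
Qed.

Lemma ranalytic_plus u v t : ranalytic u t -> ranalytic v t ->
  ranalytic (fun s => u s + v s) t.
Proof.
intros [r [M [Hr W]]] [r' [M' [Hr' W']]].
assert (H : 0 < Rmin r r') by (now apply Rmin_glb_lt).
exists (Rmin r r'), (M + M'). split; [exact H|].
apply (wiener_plus _ _ _ (fun h => u (t + h)) (fun h => v (t + h))); [lra| |].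
- apply (wiener_le r _ M); [split; [lra|apply Rmin_l]|lra|exact W].
- apply (wiener_le r' _ M'); [split; [lra|apply Rmin_r]|lra|exact W'].
Qed.

Lemma ranalytic_mult u v t : ranalytic u t -> ranalytic v t ->
  ranalytic (fun s => u s * v s) t.
Proof.
intros [r [M [Hr W]]] [r' [M' [Hr' W']]].
assert (H : 0 < Rmin r r') by (now apply Rmin_glb_lt).
exists (Rmin r r'), (M * M'). split; [exact H|].
apply (wiener_mult _ _ _ (fun h => u (t + h)) (fun h => v (t + h))); [lra| |].
- apply (wiener_le r _ M); [split; [lra|apply Rmin_l]|lra|exact W].
- apply (wiener_le r' _ M'); [split; [lra|apply Rmin_r]|lra|exact W'].
Qed.

Lemma ranalytic_ext u v t : (forall s, u s = v s) -> ranalytic u t -> ranalytic v t.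
Proof.
intros E [r [M [Hr W]]]. exists r, M. split; [exact Hr|].
eapply wiener_ext; [|exact W]. intros; apply E.
Qed.

Lemma ranalytic_sum (u : nat -> R -> R) N t : (forall i, (i <= N)%nat -> ranalytic (u i) t) ->
  ranalytic (fun s => sum_f_R0 (fun i => u i s) N) t.
Proof.
induction N as [|N IH]; intro H; simpl; [now apply H|].
apply (ranalytic_plus (fun s => sum_f_R0 (fun i => u i s) N)); [|now apply H].
apply IH. intros; apply H; lia.
Qed.

Lemma wiener_pow rho k : 0 <= rho -> exists M, wiener rho M (fun h => h ^ k).
Proof.
intro Hr. induction k as [|k [M IH]].
- exists (Rabs 1). apply (wiener_const rho 1 Hr).
- exists ((Rabs 0 + Rabs 1 * rho) * M).
  apply (wiener_mult rho _ _ (fun h => h) (fun h => h ^ k) Hr).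
  + apply (wiener_ext _ _ (fun h => 0 + 1 * h)); [intros; ring|].
    now apply wiener_affine.
  + exact IH.
Qed.

Lemma rmeromorphic_plus u v t : rmeromorphic u t -> rmeromorphic v t ->
  rmeromorphic (fun s => u s + v s) t.
Proof.
intros [m [p [r [M [Hr [W E]]]]]] [m' [p' [r' [M' [Hr' [W' E']]]]]].
set (r0 := Rmin r r').
assert (H : 0 < r0) by (now apply Rmin_glb_lt).
assert (H1 : r0 <= r) by apply Rmin_l. assert (H2 : r0 <= r') by apply Rmin_r.
destruct (wiener_pow r0 m' (Rlt_le _ _ H)) as [K WK].
destruct (wiener_pow r0 m (Rlt_le _ _ H)) as [K' WK'].
exists (m + m')%nat, (fun h => h ^ m' * p h + h ^ m * p' h), r0, (K * M + K' * M').
split; [exact H|]. split.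
- apply (wiener_plus _ _ _ (fun h => h ^ m' * p h) (fun h => h ^ m * p' h)); [lra| |].
  + apply (wiener_mult _ _ _ (fun h => h ^ m')); [lra|exact WK|].
    apply (wiener_le r _ M); trivial; lra.
  + apply (wiener_mult _ _ _ (fun h => h ^ m)); [lra|exact WK'|].
    apply (wiener_le r' _ M'); trivial; lra.
- intros h h0 Hh. rewrite E, E' by (trivial; lra). rewrite pow_add. ring.
Qed.

Lemma rmeromorphic_mult u v t : rmeromorphic u t -> rmeromorphic v t ->
  rmeromorphic (fun s => u s * v s) t.
Proof.
intros [m [p [r [M [Hr [W E]]]]]] [m' [p' [r' [M' [Hr' [W' E']]]]]].
set (r0 := Rmin r r').
assert (H : 0 < r0) by (now apply Rmin_glb_lt).
assert (H1 : r0 <= r) by apply Rmin_l. assert (H2 : r0 <= r') by apply Rmin_r.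
exists (m + m')%nat, (fun h => p h * p' h), r0, (M * M').
split; [exact H|]. split.
- apply (wiener_mult _ _ _ p p'); [lra| |].
  + apply (wiener_le r _ M); trivial; lra.
  + apply (wiener_le r' _ M'); trivial; lra.
- intros h h0 Hh. rewrite E, E' by (trivial; lra). rewrite pow_add. ring.
Qed.

Lemma rmeromorphic_const c t : rmeromorphic (fun _ => c) t.
Proof. apply ranalytic_rmeromorphic, ranalytic_const. Qed.

Lemma rmeromorphic_sum (u : nat -> R -> R) N t : (forall i, (i <= N)%nat -> rmeromorphic (u i) t) ->
  rmeromorphic (fun s => sum_f_R0 (fun i => u i s) N) t.
Proof.
induction N as [|N IH]; intro H; simpl; [now apply H|].
apply (rmeromorphic_plus (fun s => sum_f_R0 (fun i => u i s) N)); [|now apply H].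
apply IH. intros; apply H; lia.
Qed.

Lemma ranalytic_comp_affine u c d t : c <> 0 -> ranalytic u (c * t + d) ->
  ranalytic (fun s => u (c * s + d)) t.
Proof.
intros Hc [r [M [Hr W]]].
assert (Hc' := Rabs_pos_lt c Hc).
exists (r / Rabs c), M. split; [now apply Rdiv_lt_0_compat|].
apply (wiener_ext _ _ (fun h => u (c * t + d + c * h))).
- intros; f_equal; ring.
- apply (wiener_dilate r _ M c (fun h => u (c * t + d + h))); [| |exact W].
  + left; now apply Rdiv_lt_0_compat.
  + right; field; lra.
Qed.

Lemma rmeromorphic_comp_affine u c d t : c <> 0 -> rmeromorphic u (c * t + d) ->
  rmeromorphic (fun s => u (c * s + d)) t.
Proof.
intros Hc [m [p [r [M [Hr [W E]]]]]].
assert (Hc' := Rabs_pos_lt c Hc).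
exists m, (fun h => / c ^ m * p (c * h)), (r / Rabs c), (Rabs (/ c ^ m) * M).
split; [now apply Rdiv_lt_0_compat|]. split.
- apply wiener_scal, (wiener_dilate r); [| |exact W].
  + left; now apply Rdiv_lt_0_compat.
  + right; field; lra.
- intros h h0 Hh. rewrite E.
  + rewrite Rpow_mult_distr.
    replace (c * t + d + c * h) with (c * (t + h) + d) by ring.
    field. now apply pow_nonzero.
  + now apply Rmult_integral_contrapositive.
  + rewrite Rabs_mult. apply Rle_div_r in Hh; lra.
Qed.

Lemma rmeromorphic_often_zero u t : rmeromorphic u t ->
  (forall d, 0 < d -> exists h, 0 < h < d /\ u (t + h) = 0) ->
  exists d, 0 < d /\ forall h, h <> 0 -> Rabs h < d -> u (t + h) = 0.
Proof.
intros [m [p [r [M [Hr [W E]]]]]] H. exists r. split; [exact Hr|].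
intros h h0 Hh.
assert (Z : p h = 0).
{ apply (wiener_often_zero r M p Hr W); [|exact Hh].
  intros d Hd. destruct (H (Rmin d r)) as [k [[k0 k1] Hk]]; [now apply Rmin_glb_lt|].
  apply Rmin_Rgt in k1. exists k. split; [lra|].
  rewrite E, Hk by (try (rewrite Rabs_pos_eq); lra). ring. }
rewrite E in Z by lra. apply Rmult_integral in Z.
destruct Z as [Z|Z]; [|exact Z]. exfalso. now apply (pow_nonzero h m).
Qed.

(* The supremum [b] of the points near which [u] is not identically zero would
   be a limit from the right of zeros of [u], making [u] vanish around [b]. *)
Lemma rmeromorphic_identity u al sg :
  (forall t, al < t -> rmeromorphic u t) -> (forall t, sg < t -> u t = 0) ->
  forall t, al < t ->
  exists d, 0 < d /\ forall h, h <> 0 -> Rabs h < d -> u (t + h) = 0.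
Proof.
intros Hm Hz.
set (good := fun t => exists d, 0 < d /\ forall h, h <> 0 -> Rabs h < d -> u (t + h) = 0).
assert (Hbig : forall t, sg < t -> good t).
{ intros t Ht. exists (t - sg). split; [lra|]. intros h _ Hh. apply Hz.
  apply Rabs_def2 in Hh. lra. }
apply NNPP. intro Hex.
apply not_all_ex_not in Hex. destruct Hex as [t1 Ht1].
apply imply_to_and in Ht1. destruct Ht1 as [Ht1 Hbad].
destruct (completeness (fun t => al < t /\ ~ good t)) as [b [Ub Lb]].
- exists sg. intros t [_ Ht]. apply Rnot_lt_le. intro C. apply Ht. now apply Hbig.
- now exists t1.
- assert (Hb : al < b) by (specialize (Ub t1 (conj Ht1 Hbad)); lra).
  assert (Gb : forall t, b < t -> good t).
  { intros t Ht. apply NNPP. intro C. specialize (Ub t). cbv beta in Ub.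
    assert (t <= b) by (apply Ub; split; [lra|exact C]). lra. }
  destruct (rmeromorphic_often_zero u b (Hm b Hb)) as [d [Hd Zd]].
  + intros d Hd. destruct (Gb (b + d / 2)) as [e [He Ze]]; [lra|].
    assert (0 < Rmin d e) by (now apply Rmin_glb_lt).
    assert (Rmin d e <= d) by apply Rmin_l. assert (Rmin d e <= e) by apply Rmin_r.
    (* A zero close to [b + d / 2] but different from it, since being good says nothing about the
       centre itself. *)
    exists (d / 2 + Rmin d e / 4). split; [lra|].
    rewrite <- (Ze (Rmin d e / 4)); [f_equal; ring|lra|rewrite Rabs_pos_eq; lra].
  + assert (Hub : b <= b - d / 2); [|lra].
    apply Lb. intros t [Ht1' Ht2]. apply Rnot_lt_le. intro C. apply Ht2.
    destruct (Rlt_dec b t) as [Hbt|Hbt]; [now apply Gb|].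
    destruct (Req_dec t b) as [->|Hne]; [now exists d|].
    (* The radius keeps [t + h] within [d] of [b] and strictly below it, hence in the punctured
       neighbourhood where [u] vanishes. *)
    exists (Rmin (b - t) (d / 2)).
    split; [apply Rmin_glb_lt; lra|].
    intros h h0 Hh. apply Rmin_Rgt in Hh.
    replace (t + h) with (b + (t - b + h)) by ring.
    destruct Hh as [Hh1 Hh2]. apply Rabs_def2 in Hh1, Hh2.
    apply Zd; [lra|]. apply Rabs_def1; lra.
Qed.

(* While [m] exceeds 1, the hypothesis makes [h ^ m * u (t + h)] vanish at 0, so
   that a factor [h] can be divided out of its power series. *)
Lemma rmeromorphic_simple_pole u t C d : rmeromorphic u t -> 0 < d ->
  (forall h, 0 < h < d -> Rabs (h * u (t + h) - 1) <= C * h) ->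
  exists g, jet (fun h => h * u (t + h)) 1 g.
Proof.
intros [m [p [r [M [Hr [W E]]]]]] Hd HC.
assert (Q : exists q M', wiener r M' q /\ forall h, h <> 0 -> Rabs h <= r -> q h = h * u (t + h)).
{ revert p M W E. induction m as [|[|m] IH]; intros p M W E.
  - exists (fun h => (0 + 1 * h) * p h), ((Rabs 0 + Rabs 1 * r) * M). split.
    + apply (wiener_mult r _ _ (fun h => 0 + 1 * h)); [lra|apply wiener_affine; lra|exact W].
    + intros h h0 Hh. rewrite E by trivial. simpl. ring.
  - exists p, M. split; [exact W|]. intros h h0 Hh. rewrite E by trivial. simpl. ring.
  - destruct (wiener_step _ _ _ Hr W) as [q [Wq Eq]].
    assert (P0 : p 0 = 0).
    { apply (eq_0_small _ (Rabs C + 1 + M / r)). intros e He.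
      set (k := Rmin (Rmin e 1) (Rmin d r)).
      assert (Hk : 0 < k) by (repeat apply Rmin_glb_lt; lra).
      assert (K1 : k <= e) by (unfold k; eapply Rle_trans; [apply Rmin_l|apply Rmin_l]).
      assert (K2 : k <= 1) by (unfold k; eapply Rle_trans; [apply Rmin_l|apply Rmin_r]).
      assert (K3 : k <= d) by (unfold k; eapply Rle_trans; [apply Rmin_r|apply Rmin_l]).
      assert (K4 : k <= r) by (unfold k; eapply Rle_trans; [apply Rmin_r|apply Rmin_r]).
      exists (k / 2). split; [lra|]. set (h := k / 2) in *.
      assert (h0 : 0 < h < 1) by (unfold h; lra).
      assert (h1 : Rabs h <= r) by (rewrite Rabs_pos_eq; unfold h; lra).
      assert (Bq := wiener_bound _ _ _ h Wq h1).
      assert (BC := HC h ltac:(unfold h; lra)).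
      replace (p 0) with (p h + - (h * q h)) by (rewrite (Eq h h1); ring).
      eapply Rle_trans; [apply Rabs_triang|].
      rewrite Rabs_Ropp, Rabs_mult, (Rabs_pos_eq h) by lra.
      rewrite E by lra.
      replace (h ^ S (S m) * u (t + h)) with (h * (h ^ m * (h * u (t + h)))) by (simpl; ring).
      rewrite (Rabs_mult h (h ^ m * _)), (Rabs_mult (h ^ m)), (Rabs_pos_eq h) by lra.
      assert (P1 : 0 <= h ^ m <= 1).
      { split; [apply pow_le; lra|]. rewrite <- (pow1 m). apply pow_incr; lra. }
      assert (P2 : Rabs (h * u (t + h)) <= Rabs C + 1).
      { replace (h * u (t + h)) with ((h * u (t + h) - 1) + 1) by ring.
        eapply Rle_trans; [apply Rabs_triang|]. rewrite Rabs_R1.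
        pose proof (Rle_abs C). pose proof (Rabs_pos C). nra. }
      rewrite (Rabs_pos_eq (h ^ m)) by lra.
      pose proof (Rabs_pos (h * u (t + h))).
      assert (h ^ m * Rabs (h * u (t + h)) <= Rabs C + 1) by nra. nra. }
    apply (IH q (M / r) Wq). intros h h0 Hh.
    apply (Rmult_eq_reg_l h); [|exact h0].
    rewrite P0 in Eq. specialize (Eq h Hh). rewrite E in Eq by trivial.
    rewrite Rplus_0_l in Eq. rewrite <- Eq. simpl. ring. }
destruct Q as [q [M' [Wq Eq]]].
destruct (wiener_jet _ _ _ Hr Wq) as [g Hg].
exists g.
assert (J : jet (fun h => h * u (t + h)) (q 0) g).
{ apply (jet_ext q _ _ _ r Hr); [|exact Hg].
  intros h Hh. apply Eq; [lra|]. rewrite Rabs_pos_eq; lra. }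
(* The value at 0 of the analytic extension can only be the limit prescribed by the hypothesis. *)
replace 1 with (q 0); [exact J|].
apply Rminus_diag_uniq. destruct J as [D [e [He HD]]].
apply (eq_0_small _ (Rabs C + Rabs D + Rabs g)). intros e' He'.
set (k := Rmin (Rmin e e') (Rmin d 1)).
assert (Hk : 0 < k) by (repeat apply Rmin_glb_lt; lra).
assert (K1 : k <= e) by (unfold k; eapply Rle_trans; [apply Rmin_l|apply Rmin_l]).
assert (K2 : k <= e') by (unfold k; eapply Rle_trans; [apply Rmin_l|apply Rmin_r]).
assert (K3 : k <= d) by (unfold k; eapply Rle_trans; [apply Rmin_r|apply Rmin_l]).
assert (K4 : k <= 1) by (unfold k; eapply Rle_trans; [apply Rmin_r|apply Rmin_r]).
exists (k / 2). split; [lra|]. set (h := k / 2) in *.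
assert (h0 : 0 < h < 1) by (unfold h; lra).
specialize (HC h ltac:(unfold h; lra)). specialize (HD h ltac:(unfold h; lra)).
replace (q 0 - 1) with ((h * u (t + h) - 1) + - (h * u (t + h) - q 0 - g * h) + - (g * h)) by ring.
eapply Rle_trans; [apply Rabs_triang|]. eapply Rle_trans; [apply Rplus_le_compat_r, Rabs_triang|].
rewrite !Rabs_Ropp, (Rabs_mult g), (Rabs_pos_eq h) by lra.
pose proof (Rle_abs C). pose proof (Rle_abs D). pose proof (Rabs_pos D).
assert (C * h <= Rabs C * h) by (apply Rmult_le_compat_r; lra).
assert (D * h ^ 2 <= Rabs D * h ^ 2) by (apply Rmult_le_compat_r; nra).
assert (Rabs D * h ^ 2 <= Rabs D * h) by (apply Rmult_le_compat_l; nra).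
lra.
Qed.

(** One number in two forms: a jet, for computations, and a limit of difference quotients, the form
    in which [C_derive] is defined. *)
Lemma ranalytic_jet u t : ranalytic u t -> exists c,
  jet (fun h => u (t + h)) (u t) c /\ is_lim (fun x => (u x - u t) / (x - t)) t c.
Proof.
intros [rho [M [Hr W]]].
destruct (wiener_expand _ _ _ Hr W) as [c [r [Wr [J E]]]].
exists c. rewrite Rplus_0_r in *. split; [exact J|].
apply is_lim_spec. intro eps.
set (B := Rabs (M / rho / rho) + 1).
assert (HB : 0 < B) by (unfold B; pose proof (Rabs_pos (M / rho / rho)); lra).
assert (Hd : 0 < Rmin rho (eps / B)).
{ apply Rmin_glb_lt; [exact Hr|]. apply Rdiv_lt_0_compat; [apply cond_pos|exact HB]. }
exists (mkposreal _ Hd). intros y Hy Hne.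
unfold ball in Hy; simpl in Hy. unfold AbsRing_ball, abs, minus, plus, opp in Hy; simpl in Hy.
apply Rmin_Rgt in Hy. destruct Hy as [Hy1 Hy2].
change (y + - t) with (y - t) in *. set (h := y - t) in *.
replace (u y) with (u (t + h)) by (f_equal; unfold h; ring).
rewrite (E h) by lra. assert (h <> 0) by (unfold h; lra).
replace ((u t + c * h + h ^ 2 * r h - u t) / h - c) with (h * r h) by (field; trivial).
assert (Br := wiener_bound _ _ _ h Wr (Rlt_le _ _ Hy1)).
apply Rlt_div_r in Hy2; [|exact HB].
rewrite Rabs_mult. eapply Rle_lt_trans; [|exact Hy2].
apply Rmult_le_compat_l; [apply Rabs_pos|].
pose proof (Rle_abs (M / rho / rho)). unfold B. lra.
Qed.

(** * Restriction of complex functions to the real axis *)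

Lemma wiener_of_series (a : nat -> R) (f : R -> R) (r : R) : 0 < r ->
  (forall h, Rabs h < r -> is_series (fun j => a j * h ^ j) (f h)) ->
  exists rho M, 0 < rho /\ wiener rho M f.
Proof.
intros Hr Hs.
assert (H0 := Hs (r / 2) ltac:(rewrite Rabs_pos_eq; lra)).
assert (HL := ex_series_lim_0 _ (ex_intro _ _ H0)).
destruct (maj_by_pos (fun j => a j * (r / 2) ^ j)) as [B [HB Hb]].
{ exists 0. now apply is_lim_seq_Reals. }
(* Convergence at [r / 2] bounds the terms there by [B]; at half that radius they are dominated by a
   geometric series of sum [2 * B]. *)
exists (r / 2 / 2), (2 * B). split; [lra|]. exists a. split.
- intro N.
  assert (HG := is_series_geom (/ 2) ltac:(rewrite Rabs_pos_eq; lra)).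
  apply Rle_trans with (sum_f_R0 (fun j => (/ 2) ^ j * B) N).
  + apply sum_Rle. intros j _. specialize (Hb j).
    rewrite Rabs_mult, (Rabs_pos_eq ((r / 2) ^ j)) in Hb by (apply pow_le; lra).
    replace ((r / 2 / 2) ^ j) with ((r / 2) ^ j * (/ 2) ^ j)
      by (rewrite <- Rpow_mult_distr; reflexivity).
    rewrite <- Rmult_assoc, (Rmult_comm _ B). apply Rmult_le_compat_r; [apply pow_le; lra|exact Hb].
  + rewrite <- scal_sum, Rmult_comm. apply Rmult_le_compat_r; [lra|].
    eapply Rle_trans; [apply sum_le_Series; [intro; apply pow_le; lra|eexists; exact HG]|].
    right. etransitivity; [exact (is_series_unique _ _ HG)|field].
- intros h Hh. apply Hs. lra.
Qed.

Lemma is_series_Re (c : nat -> C) (l : C) :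
  @is_series C_AbsRing C_NormedModule c l ->
  is_series (fun j => Re (c j)) (Re l) /\ is_series (fun j => Im (c j)) (Im l).
Proof.
intro H.
assert (S : forall N, Re (@sum_n C_AbsRing c N) = sum_n (fun j => Re (c j)) N /\
                      Im (@sum_n C_AbsRing c N) = sum_n (fun j => Im (c j)) N).
{ induction N as [|N [I1 I2]]; [now rewrite !sum_O|].
  rewrite !sum_Sn, <- I1, <- I2. split; reflexivity. }
assert (L : forall eps : posreal, eventually (fun N =>
  Rabs (Re (@sum_n C_AbsRing c N) - Re l) < eps /\
  Rabs (Im (@sum_n C_AbsRing c N) - Im l) < eps)).
{ intro eps. apply (H (fun y => Rabs (Re y - Re l) < eps /\ Rabs (Im y - Im l) < eps)).
  (* The balls of [C] used here are products of two real balls, so closeness is coordinatewise. *)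
  exists eps. intros y Hy. exact Hy. }
split; apply (proj1 (is_lim_seq_spec (sum_n _) (Finite _))); intro eps; destruct (L eps) as [N0 HN]; exists N0;
  intros N H0; destruct (HN N H0) as [HN1 HN2].
- now rewrite <- (proj1 (S N)).
- now rewrite <- (proj2 (S N)).
Qed.

Lemma is_pseries_Re (a : nat -> C) (h : R) (l : C) :
  @is_pseries C_AbsRing C_NormedModule a (RtoC h) l ->
  is_series (fun j => Re (a j) * h ^ j) (Re l) /\
  is_series (fun j => Im (a j) * h ^ j) (Im l).
Proof.
intro H. apply is_series_Re in H.
assert (P : forall j, @pow_n C_AbsRing (RtoC h) j = RtoC (h ^ j)).
{ induction j as [|j IH]; [reflexivity|].
  change (@pow_n C_AbsRing (RtoC h) (S j)) with (RtoC h * @pow_n C_AbsRing (RtoC h) j)%C.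
  now rewrite IH, <- RtoC_mult. }
destruct H as [H1 H2].
split; [eapply is_series_ext; [|exact H1]|eapply is_series_ext; [|exact H2]];
  intro j; cbv beta; rewrite P; destruct (a j) as [x y]; unfold scal; simpl;
  unfold Cmult; simpl; ring_R.
Qed.

Lemma analytic_at_real (f : C -> C) (t : R) : analytic_at f (RtoC t) ->
  ranalytic (fun s => Re (f (RtoC s))) t /\ ranalytic (fun s => Im (f (RtoC s))) t.
Proof.
intros [a [r Ha]].
assert (E : forall h, Rabs h < r ->
  @is_pseries C_AbsRing C_NormedModule a (RtoC h) (f (RtoC (t + h)))).
{ intros h Hh. assert (D : (RtoC (t + h) - RtoC t)%C = RtoC h)
    by (rewrite <- RtoC_minus; f_equal; ring).
  specialize (Ha (RtoC (t + h))). rewrite D in Ha. apply Ha. now rewrite Cmod_R. }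
split.
- apply (wiener_of_series (fun j => Re (a j)) (fun h => Re (f (RtoC (t + h)))) r (cond_pos r)).
  intros h Hh. apply (is_pseries_Re _ _ _ (E h Hh)).
- apply (wiener_of_series (fun j => Im (a j)) (fun h => Im (f (RtoC (t + h)))) r (cond_pos r)).
  intros h Hh. apply (is_pseries_Re _ _ _ (E h Hh)).
Qed.

Lemma meromorphic_at_real (f : C -> C) (t : R) : meromorphic_at f (RtoC t) ->
  rmeromorphic (fun s => Re (f (RtoC s))) t /\ rmeromorphic (fun s => Im (f (RtoC s))) t.
Proof.
intros [m H]. apply analytic_at_real in H.
assert (D : forall h, ((RtoC (t + h) - RtoC t) ^ m)%C = RtoC (h ^ m)).
{ intro h. rewrite <- RtoC_minus, <- RtoC_pow. do 2 f_equal. ring. }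
destruct H as [[r1 [M1 [Hr1 W1]]] [r2 [M2 [Hr2 W2]]]]. split.
- exists m. eexists. exists r1, M1. split; [exact Hr1|split; [exact W1|]].
  intros h _ _. cbv beta. rewrite D. destruct (f (RtoC (t + h))); simpl; ring.
- exists m. eexists. exists r2, M2. split; [exact Hr2|split; [exact W2|]].
  intros h _ _. cbv beta. rewrite D. destruct (f (RtoC (t + h))); simpl; ring.
Qed.

Lemma is_lim_ext_away (f g : R -> R) (t l : R) :
  (forall x, x <> t -> f x = g x) -> is_lim f t l -> is_lim g t l.
Proof.
intros E H. apply (is_lim_ext_loc f g t l); [|exact H].
exists (mkposreal 1 Rlt_0_1). intros y _ Hy. now apply E.
Qed.

(* Coquelicot's [C_derive] is a limit along the real direction only, so at a
   real point it depends only on the values of [f] on the real axis. *)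
Lemma C_derive_jet (f : C -> C) (t : R) : analytic_at f (RtoC t) ->
  jet (fun h => Re (f (RtoC (t + h)))) (Re (f (RtoC t))) (Re (C_derive f (RtoC t))) /\
  jet (fun h => Im (f (RtoC (t + h)))) (Im (f (RtoC t))) (Im (C_derive f (RtoC t))).
Proof.
intro H. destruct (analytic_at_real f t H) as [H1 H2].
destruct (ranalytic_jet _ _ H1) as [c1 [J1 L1]].
destruct (ranalytic_jet _ _ H2) as [c2 [J2 L2]].
assert (E : forall x, x <> t ->
  ((f (x, 0) - f (RtoC t)) / ((x, 0) - RtoC t))%C =
  ((Re (f (RtoC x)) - Re (f (RtoC t))) / (x - t),
   (Im (f (RtoC x)) - Im (f (RtoC t))) / (x - t))).
{ intros x Hx. change (x, 0) with (RtoC x). rewrite <- RtoC_minus.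
  destruct (f (RtoC x)) as [p q], (f (RtoC t)) as [p' q'].
  unfold Cdiv. rewrite <- RtoC_inv by lra.
  unfold Cmult, Cminus, Cplus, Copp, RtoC, Re, Im; simpl. f_equal; field; lra. }
assert (Ed : C_derive f (RtoC t) = (c1, c2)).
{ unfold C_derive, C_lim. apply injective_projections; simpl.
  - apply (f_equal real (y := Finite c1)), is_lim_unique.
    eapply is_lim_ext_away; [|exact L1]. intros x Hx. exact (eq_sym (f_equal fst (E x Hx))).
  - apply (f_equal real (y := Finite c2)), is_lim_unique.
    eapply is_lim_ext_away; [|exact L2]. intros x Hx. exact (eq_sym (f_equal snd (E x Hx))). }
rewrite Ed. now split.
Qed.

(** * The binomial series *)

(* [negbin l s] is the coefficient of [y ^ l] in [(1 - y) ^ (- s)]. *)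
Fixpoint negbin (l : nat) (s : R) : R :=
  match l with
  | 0%nat => 1
  | S l' => negbin l' s * ((s + INR l') / INR (S l'))
  end.

Lemma negbin_pos l s : 0 < s -> 0 < negbin l s.
Proof.
intro Hs. induction l as [|l IH]; [simpl; lra|].
change (0 < negbin l s * ((s + INR l) / INR (S l))).
apply Rmult_lt_0_compat; [exact IH|]. apply Rdiv_lt_0_compat; [|apply lt_0_INR; lia].
pose proof (pos_INR l). lra.
Qed.

(** [negbin l] is a polynomial with nonnegative coefficients, so its norm around [t] is at most its
    value at [Rabs t + rho]. As this bound is again a binomial coefficient, the binomial series
    itself sums such bounds over [l]. *)
Lemma negbin_wiener l rho t : 0 < rho ->
  wiener rho (negbin l (Rabs t + rho)) (fun h => negbin l (t + h)).
Proof.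
intro Hr. induction l as [|l IH].
- rewrite <- Rabs_R1 at 1. apply (wiener_const rho 1). lra.
- assert (Hl : 0 < INR (S l)) by (apply lt_0_INR; lia).
  apply (wiener_mult _ _ _ (fun h => negbin l (t + h))); [lra|exact IH|].
  apply (wiener_ext _ _ (fun h => (t + INR l) / INR (S l) + / INR (S l) * h)).
  { intros. field. lra. }
  eapply wiener_le; [| |exact (wiener_affine rho _ _ (Rlt_le _ _ Hr))]; [lra|].
  unfold Rdiv. rewrite Rabs_mult, (Rabs_pos_eq (/ _)) by (left; now apply Rinv_0_lt_compat).
  pose proof (Rabs_triang t (INR l)). rewrite (Rabs_pos_eq (INR l)) in H by apply pos_INR.
  apply Rinv_0_lt_compat in Hl. nra.
Qed.

Lemma negbin_ranalytic l t : ranalytic (negbin l) t.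
Proof.
exists 1, (negbin l (Rabs t + 1)). split; [lra|]. apply negbin_wiener. lra.
Qed.

Lemma harmonic_S m : harmonic (S m) = harmonic m + / INR (S m).
Proof. unfold harmonic. rewrite sum_n_Sm by lia. reflexivity. Qed.

(** The coefficient is h/(l+1) times the product of the 1 + h/j for j = 1, ..., l, whose derivative
    at 0 is H_l. This is the origin of the harmonic numbers. *)
Lemma negbin_zero_factor l : exists p,
  (forall h, negbin (S l) h = h * p h) /\ jet p (/ INR (S l)) (harmonic l / INR (S l)).
Proof.
induction l as [|l [p [Hp J]]].
- exists (fun _ => 1). split.
  + intro h. simpl. field.
  + simpl. unfold harmonic. rewrite sum_n_m_zero by lia.
    change (zero : R) with 0. replace (0 / 1) with 0 by field. rewrite Rinv_1.
    apply jet_const.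
- assert (Hl : 0 < INR (S l)) by (apply lt_0_INR; lia).
  exists (fun h => p h * (INR (S l) / INR (S (S l)) + / INR (S (S l)) * h)). split.
  + intro h. change (negbin (S (S l)) h) with (negbin (S l) h * ((h + INR (S l)) / INR (S (S l)))).
    rewrite Hp, (S_INR (S l)). field. lra.
  + assert (J2 := jet_mult _ _ _ _ _ _ J (jet_affine (INR (S l) / INR (S (S l))) (/ INR (S (S l))))).
    assert (E0 : / INR (S l) * (INR (S l) / INR (S (S l))) = / INR (S (S l)))
      by (rewrite (S_INR (S l)); field; lra).
    assert (E1 : / INR (S l) * / INR (S (S l)) + harmonic l / INR (S l) * (INR (S l) / INR (S (S l)))
      = harmonic (S l) / INR (S (S l)))
      by (rewrite harmonic_S, (S_INR (S l)); field; lra).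
    rewrite E0, E1 in J2. exact J2.
Qed.

Lemma CV_radius_negbin s : 0 < s -> CV_radius (fun l => negbin l s) = Finite 1.
Proof.
intro Hs. replace 1 with (/ 1) at 1 by field.
apply CV_radius_finite_DAlembert; [|lra|].
- intro l. apply Rgt_not_eq, negbin_pos, Hs.
- apply (is_lim_seq_ext (fun l => 1 + (s - 1) * / INR (S l))).
  + intro l. pose proof (pos_INR l). assert (P := negbin_pos l s Hs).
    change (negbin (S l) s) with (negbin l s * ((s + INR l) / INR (S l))).
    rewrite S_INR. replace (negbin l s * ((s + INR l) / (INR l + 1)) / negbin l s)
      with ((s + INR l) / (INR l + 1)) by (field; lra).
    rewrite Rabs_pos_eq by (left; apply Rdiv_lt_0_compat; lra). field. lra.
  + replace (Finite 1) with (Finite (1 + (s - 1) * 0)) by (f_equal; ring).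
    apply is_lim_seq_plus'; [apply is_lim_seq_const|].
    apply (is_lim_seq_scal_l _ (s - 1) (Finite 0)).
    apply (is_lim_seq_incr_1 (fun l => / INR l)).
    apply (is_lim_seq_inv _ p_infty); [apply is_lim_seq_INR|discriminate].
Qed.

(** The recurrence of the coefficients says that the sum F satisfies (1 - x) F' = s F. So F(x) (1 -
    x)^s has derivative 0 on (-1, 1) and keeps its value 1 at 0. *)
Lemma negbin_series s y : 0 < s -> Rabs y < 1 ->
  is_series (fun l => negbin l s * y ^ l) (Rpower (1 - y) (- s)).
Proof.
intros Hs Hy.
set (a := fun l => negbin l s).
assert (HR : forall x, Rabs x < 1 -> Rbar_lt (Rabs x) (CV_radius a))
  by (intros x Hx; unfold a; now rewrite CV_radius_negbin).
assert (Ode : forall x, Rabs x < 1 -> (1 - x) * PSeries (PS_derive a) x = s * PSeries a x).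
{ intros x Hx. assert (HRx := HR x Hx).
  rewrite <- (PSeries_scal s), Rmult_minus_distr_r, Rmult_1_l, <- PSeries_incr_1, <- PSeries_minus.
  - apply PSeries_ext. intros [|l]; unfold PS_minus, PS_incr_1, PS_derive, PS_scal, a,
      plus, opp, zero, scal, mult; cbn -[INR negbin]; unfold mult; cbn -[INR negbin].
    + simpl. field.
    + change (negbin (S (S l)) s) with (negbin (S l) s * ((s + INR (S l)) / INR (S (S l)))).
      rewrite (S_INR (S l)). pose proof (pos_INR (S l)). field. lra.
  - now apply ex_pseries_derive.
  - now apply ex_pseries_incr_1, ex_pseries_derive. }
set (G := fun x => PSeries a x * exp (s * ln (1 - x))).
assert (D : forall x, Rabs x < 1 -> is_derive G x 0).
{ intros x Hx. assert (HRx := HR x Hx). assert (Hx' := Rabs_def2 _ _ Hx).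
  unfold G. evar_last.
  - apply (is_derive_mult (PSeries a) (fun x => exp (s * ln (1 - x)))).
    + now apply is_derive_PSeries.
    + auto_derive; [lra|reflexivity].
    + intros; apply Rmult_comm.
  - unfold plus, mult; simpl.
    replace (PSeries (PS_derive a) x) with (s * PSeries a x / (1 - x))
      by (rewrite <- Ode by exact Hx; field; lra).
    change (1 + - x) with (1 - x). field. lra. }
assert (G0 : G 0 = 1).
{ unfold G. rewrite PSeries_0, Rminus_0_r, ln_1, Rmult_0_r, exp_0. unfold a; simpl. ring. }
assert (Gy : G y = 1).
{ apply Rabs_def2 in Hy. destruct (Rtotal_order y 0) as [Hy0|[->|Hy0]]; [|exact G0|].
  - rewrite <- G0. apply (eq_is_derive (V := R_NormedModule) G); [|exact Hy0].
    intros t Ht. apply D, Rabs_def1; lra.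
  - rewrite <- G0. symmetry. apply (eq_is_derive (V := R_NormedModule) G); [|exact Hy0].
    intros t Ht. apply D, Rabs_def1; lra. }
assert (E : PSeries a y = Rpower (1 - y) (- s)).
{ unfold G in Gy. rewrite Rpower_Ropp. unfold Rpower.
  apply (Rmult_eq_reg_r (exp (s * ln (1 - y)))); [|apply Rgt_not_eq, exp_pos].
  rewrite Gy. field. apply Rgt_not_eq, exp_pos. }
rewrite <- E. apply is_pseries_R. apply PSeries_correct, CV_radius_inside, HR, Hy.
Qed.

Lemma ex_series_even (a : nat -> R) : (forall j, 0 <= a j) -> ex_series a ->
  ex_series (fun l => a (2 * l)%nat).
Proof.
intros Ha Ea. apply (is_series_bounded_pos _ (Series a)); [intro; apply Ha|].
intro N. apply Rle_trans with (sum_f_R0 a (2 * N)); [|now apply sum_le_Series].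
induction N as [|N IH]; [simpl; lra|].
replace (2 * S N)%nat with (S (S (2 * N))) by lia. rewrite !tech5.
replace (2 * S N)%nat with (S (S (2 * N))) by lia.
pose proof (Ha (S (2 * N))). lra.
Qed.

Lemma ex_series_odd (a : nat -> R) : (forall j, 0 <= a j) -> ex_series a ->
  ex_series (fun l => a (2 * l + 1)%nat).
Proof.
intros Ha Ea. apply (is_series_bounded_pos _ (Series a)); [intro; apply Ha|].
intro N. apply Rle_trans with (sum_f_R0 a (2 * N + 1)); [|now apply sum_le_Series].
induction N as [|N IH]; [simpl; pose proof (Ha 0%nat); lra|].
replace (2 * S N + 1)%nat with (S (S (2 * N + 1))) by lia. rewrite !tech5.
replace (2 * S N + 1)%nat with (S (S (2 * N + 1))) by lia.
pose proof (Ha (S (2 * N + 1))). lra.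
Qed.

Lemma negbin_abs_series s y : 0 < s -> 0 <= y < 1 -> ex_series (fun l => negbin l s * y ^ l).
Proof.
intros Hs Hy. eexists. apply negbin_series; [exact Hs|]. rewrite Rabs_pos_eq; lra.
Qed.

(** In the sum of the binomial series at [y] and [- y] the odd terms cancel. *)
Lemma negbin_even_series s y : 0 < s -> 0 <= y < 1 ->
  is_series (fun l => 2 * negbin (2 * l) s * y ^ (2 * l))
            (Rpower (1 - y) (- s) + Rpower (1 + y) (- s)).
Proof.
intros Hs Hy.
assert (P : forall j, 0 <= negbin j s * y ^ j)
  by (intro j; apply Rmult_le_pos; [left; now apply negbin_pos|apply pow_le; lra]).
assert (E := negbin_abs_series s y Hs Hy).
destruct (ex_series_even _ P E) as [l1 H1]. destruct (ex_series_odd _ P E) as [l2 H2].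
assert (E1 : is_pseries (fun l => negbin (2 * l) s) (y ^ 2) l1).
{ apply is_pseries_R. eapply is_series_ext; [|exact H1]. intro j. cbv beta. now rewrite pow_mult. }
(* The odd part is written as [y] times a series in [y ^ 2] of sum [l2 / y], which requires
   [y <> 0]. *)
destruct (Req_dec y 0) as [Hy0|Hy0].
- subst y. rewrite Rminus_0_r, Rplus_0_r. unfold Rpower. rewrite ln_1, Rmult_0_r, exp_0.
  replace (1 + 1) with (sum_f_R0 (fun l => 2 * negbin (2 * l) s * 0 ^ (2 * l)) 0) by (simpl; ring).
  apply is_series_finite. intros j Hj. rewrite (pow_ne_zero (2 * j)) by lia. ring.
- assert (E2 : is_pseries (fun l => negbin (2 * l + 1) s) (y ^ 2) (l2 / y)).
  { apply is_pseries_R.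
    assert (E3 : is_series (fun l => / y * (negbin (2 * l + 1) s * y ^ (2 * l + 1))) (/ y * l2))
      by exact (is_series_scal_l _ _ _ H2).
    replace (l2 / y) with (/ y * l2) by (field; exact Hy0).
    eapply is_series_ext; [|exact E3]. intro j. cbv beta.
    rewrite pow_add, pow_mult. simpl (y ^ 1). field_R. exact Hy0. }
  assert (F1 := is_pseries_odd_even (fun l => negbin l s) y _ _ E1 E2).
  assert (F2 := is_pseries_odd_even (fun l => negbin l s) (- y) l1 (l2 / y)).
  replace ((- y) ^ 2) with (y ^ 2) in F2 by ring. specialize (F2 E1 E2).
  apply is_pseries_R in F1, F2.
  assert (G1 := negbin_series s y Hs ltac:(rewrite Rabs_pos_eq; lra)).
  assert (G2 := negbin_series s (- y) Hs ltac:(rewrite Rabs_Ropp, Rabs_pos_eq; lra)).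
  assert (U1 := eq_trans (eq_sym (is_series_unique _ _ F1)) (is_series_unique _ _ G1)).
  assert (U2 := eq_trans (eq_sym (is_series_unique _ _ F2)) (is_series_unique _ _ G2)).
  replace (1 - - y) with (1 + y) in U2 by ring. rewrite <- U1, <- U2.
  replace (l1 + y * (l2 / y) + (l1 + - y * (l2 / y))) with (2 * l1) by (field; exact Hy0).
  assert (E3 : is_series (fun l => 2 * (negbin (2 * l) s * y ^ (2 * l))) (2 * l1))
    by exact (is_series_scal_l _ _ _ H1).
  eapply is_series_ext; [|exact E3]. intro j. cbv beta. symmetry. apply Rmult_assoc.
Qed.

(** * Riemann and Hurwitz zeta functions *)

Lemma Rpower_pos x y : 0 < Rpower x y.
Proof. apply exp_pos. Qed.

Lemma Rpower_neg_antitone x y s : 0 <= s -> 0 < x <= y -> Rpower y (- s) <= Rpower x (- s).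
Proof.
intros Hs Hxy. rewrite !Rpower_Ropp. apply Rinv_le_contravar; [apply Rpower_pos|].
now apply Rle_Rpower_l.
Qed.

(** The mean value theorem stands in for the comparison of a sum with an integral: the middle term
    telescopes along [x], [x + 1], and so on. *)
Lemma Rpower_difference x h : 0 < x -> 0 < h ->
  h * Rpower (x + 1) (- (1 + h)) <= Rpower x (- h) - Rpower (x + 1) (- h)
    <= h * Rpower x (- (1 + h)).
Proof.
intros Hx Hh.
destruct (MVT_cor2 (fun x => Rpower x (- h)) (fun x => - h * Rpower x (- h - 1)) x (x + 1))
  as [c [Hc Hc']]; [lra| |].
- intros c Hc. apply derivable_pt_lim_power. lra.
- replace (- h - 1) with (- (1 + h)) in Hc by ring.
  assert (L1 := Rpower_neg_antitone x c (1 + h) ltac:(lra) ltac:(lra)).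
  assert (L2 := Rpower_neg_antitone c (x + 1) (1 + h) ltac:(lra) ltac:(lra)).
  replace (x + 1 - x) with 1 in Hc by ring. nra.
Qed.

Lemma Rpower_neg_lim c h : 0 < c -> 0 < h ->
  is_lim_seq (fun j => Rpower (INR j + c) (- h)) 0.
Proof.
intros Hc Hh. unfold Rpower.
assert (L : is_lim_seq (fun j => INR j + c) p_infty).
{ replace p_infty with (Rbar_plus p_infty c) by reflexivity.
  eapply is_lim_seq_plus; [apply is_lim_seq_INR|apply is_lim_seq_const|reflexivity]. }
apply (is_lim_comp_seq exp _ m_infty); [apply is_lim_exp_m|exists 0%nat; discriminate|].
replace m_infty with (Rbar_mult (- h) p_infty).
- apply is_lim_seq_scal_l.
  apply (is_lim_comp_seq ln _ p_infty); [apply is_lim_ln_p|exists 0%nat; discriminate|exact L].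
- simpl. destruct Rle_dec as [r|r]; [exfalso; lra|reflexivity].
Qed.

(** Telescoping squeezes the sum between c^(-h)/h and 1 + 1/h. After multiplication by [h] both
    bounds are 1 + O(h), from which the residue 1 is read off. *)
Lemma power_sum_bounds c h : 1 <= c -> 0 < h ->
  ex_series (fun j => Rpower (INR j + c) (- (1 + h))) /\
  1 - h * ln c <= h * Series (fun j => Rpower (INR j + c) (- (1 + h))) <= 1 + h.
Proof.
intros Hc Hh. set (a := fun j => Rpower (INR j + c) (- (1 + h))).
assert (P : forall j, 0 <= a j) by (intro; left; apply Rpower_pos).
assert (X : forall j, 0 < INR j + c) by (intro j; pose proof (pos_INR j); lra).
assert (Pc : Rpower c (- h) <= 1 /\ Rpower c (- (1 + h)) <= 1).
{ assert (E : forall y, Rpower 1 y = 1)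
    by (intro y; unfold Rpower; rewrite ln_1, Rmult_0_r; apply exp_0).
  split; (eapply Rle_trans; [apply (Rpower_neg_antitone 1 c); lra|right; apply E]). }
assert (U : forall N, sum_f_R0 a N <= a 0%nat + (Rpower c (- h) - Rpower (INR N + c) (- h)) / h).
{ induction N as [|N IH]; [simpl; rewrite Rplus_0_l, Rminus_diag; unfold Rdiv; lra|].
  rewrite tech5. destruct (Rpower_difference (INR N + c) h (X N) Hh) as [D _].
  replace (INR N + c + 1) with (INR (S N) + c) in D by (rewrite S_INR; ring).
  fold (a (S N)) in D.
  assert (a (S N) <= (Rpower (INR N + c) (- h) - Rpower (INR (S N) + c) (- h)) / h)
    by (apply Rle_div_r; lra).
  unfold Rdiv in *. lra. }
assert (L : forall N, (Rpower c (- h) - Rpower (INR (S N) + c) (- h)) / h <= sum_f_R0 a N).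
{ assert (D : forall N, (Rpower (INR N + c) (- h) - Rpower (INR (S N) + c) (- h)) / h <= a N).
  { intro N. destruct (Rpower_difference (INR N + c) h (X N) Hh) as [_ D].
    replace (INR N + c + 1) with (INR (S N) + c) in D by (rewrite S_INR; ring).
    fold (a N) in D. apply Rle_div_l; lra. }
  induction N as [|N IH]; [specialize (D 0%nat); simpl in *; now rewrite Rplus_0_l in D|].
  rewrite tech5. specialize (D (S N)). unfold Rdiv in *. lra. }
assert (A0 : a 0%nat <= 1) by (unfold a; simpl; rewrite Rplus_0_l; apply Pc).
destruct (is_series_bounded_pos a (1 + 1 / h) P) as [Ea La].
{ intro N. eapply Rle_trans; [apply U|]. apply Rplus_le_compat; [exact A0|].
  apply Rmult_le_compat_r; [left; now apply Rinv_0_lt_compat|].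
  pose proof (Rpower_pos (INR N + c) (- h)). lra. }
split; [exact Ea|]. split.
- assert (B : Rpower c (- h) / h <= Series a).
  { apply (is_lim_seq_le (fun N => (Rpower c (- h) - Rpower (INR (S N) + c) (- h)) / h) (fun _ => Series a)
      (Finite (Rpower c (- h) / h)) (Finite (Series a))).
    - intro N. eapply Rle_trans; [apply L|]. now apply sum_le_Series.
    - replace (Rpower c (- h) / h) with ((Rpower c (- h) - 0) * / h) by (field; lra).
      apply (is_lim_seq_scal_r _ (/ h) (Finite (Rpower c (- h) - 0))).
      apply is_lim_seq_minus'; [apply is_lim_seq_const|].
      apply (is_lim_seq_incr_1 (fun j => Rpower (INR j + c) (- h))).
      apply Rpower_neg_lim; lra.
    - apply is_lim_seq_const. }
  apply Rle_trans with (Rpower c (- h)).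
  + unfold Rpower. eapply Rle_trans; [|apply exp_ineq1_le]. lra.
  + apply Rle_div_l in B; lra.
- apply Rle_trans with (h * (1 + 1 / h)); [apply Rmult_le_compat_l; lra|].
  right; field; lra.
Qed.

Lemma ex_series_power c s : 1 <= c -> 1 < s -> ex_series (fun j => Rpower (INR j + c) (- s)).
Proof.
intros Hc Hs. destruct (power_sum_bounds c (s - 1) Hc ltac:(lra)) as [E _].
eapply ex_series_ext; [|exact E]. intro j. cbv beta. do 2 f_equal. ring.
Qed.

Lemma power_sum_residue (W : R -> R) c : 1 <= c -> rmeromorphic W 1 ->
  (forall s, 1 < s -> is_series (fun j => Rpower (INR j + c) (- s)) (W s)) ->
  exists g, jet (fun h => h * W (1 + h)) 1 g.
Proof.
intros Hc Hm HW. apply (rmeromorphic_simple_pole W 1 (ln c + 1) 1 Hm Rlt_0_1).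
intros h Hh. destruct (power_sum_bounds c h Hc ltac:(lra)) as [_ B].
rewrite (is_series_unique _ _ (HW (1 + h) ltac:(lra))) in B.
assert (0 <= ln c).
{ rewrite <- ln_1. destruct Hc as [Hc|<-]; [left; apply ln_increasing; lra|right; reflexivity]. }
apply Rabs_le. nra.
Qed.

(** The even integers contribute 2^(-s) z, so the odd ones sum to (1 - 2^(-s)) z; the numbers j +
    1/2 are the halves of the odd integers. *)
Lemma half_integer_power_sum z s : 1 < s ->
  is_series (fun j => Rpower (INR (S j)) (- s)) z ->
  is_series (fun j => Rpower (INR j + / 2) (- s)) ((Rpower 2 s - 1) * z).
Proof.
intros Hs Hz. set (a := fun j => Rpower (INR (S j)) (- s)) in *.
assert (P : forall j, 0 <= a j) by (intro; left; apply Rpower_pos).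
(* Index [j] stands for the integer j + 1, so the even indices are the odd integers. *)
destruct (ex_series_even a P (ex_intro _ _ Hz)) as [l1 H1].
assert (H2 : is_series (fun j => a (2 * j + 1)%nat) (Rpower 2 (- s) * z)).
{ eapply is_series_ext; [|exact (is_series_scal_l (Rpower 2 (- s)) _ _ Hz)].
  intro j. unfold a, scal; simpl. unfold mult; simpl.
  rewrite Rpower_mult_distr; [|lra|apply (lt_0_INR (S j)); lia].
  f_equal. change (2 * INR (S j) = INR (S (2 * j + 1))).
  replace (S (2 * j + 1)) with (2 * S j)%nat by lia. rewrite mult_INR. reflexivity. }
assert (E : l1 + 1 * (Rpower 2 (- s) * z) = z).
{ assert (F := is_pseries_odd_even a 1 l1 (Rpower 2 (- s) * z)).
  assert (Q : forall (u : nat -> R) x l, x = 1 -> is_series u l <-> is_pseries u x l).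
  { intros u x l ->. rewrite is_pseries_R. split; apply is_series_ext; intro j; rewrite pow1; ring_R. }
  apply (Q _ 1 _ eq_refl) in Hz.
  assert (o : 1 ^ 2 = 1) by ring.
  specialize (F (proj1 (Q _ _ _ o) H1) (proj1 (Q _ _ _ o) H2)).
  rewrite <- (is_pseries_unique _ _ _ F). apply (is_pseries_unique _ _ _ Hz). }
assert (P2 := Rpower_pos 2 s).
replace ((Rpower 2 s - 1) * z) with (Rpower 2 s * l1).
- eapply is_series_ext; [|exact (is_series_scal_l (Rpower 2 s) _ _ H1)].
  intro j. unfold a, scal; simpl. unfold mult; simpl.
  assert (Hj : 0 < INR j + / 2) by (pose proof (pos_INR j); lra).
  change (Rpower 2 s * Rpower (INR (S (2 * j))) (- s) = Rpower (INR j + / 2) (- s)).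
  replace (INR (S (2 * j))) with (2 * (INR j + / 2))
    by (rewrite S_INR, mult_INR; simpl; field).
  rewrite <- Rpower_mult_distr by lra. rewrite (Rpower_Ropp 2). field. lra.
- rewrite Rpower_Ropp in E. replace l1 with (z - / Rpower 2 s * z) by lra. field. lra.
Qed.

Lemma Cpow_pos_real x s : Cpow_pos x (RtoC s) = RtoC (Rpower x s).
Proof.
unfold Cpow_pos, Cexp, Rpower. rewrite <- RtoC_mult. unfold RtoC, Re, Im; simpl.
rewrite cos_0, sin_0. f_equal; ring.
Qed.

Lemma zeta_real_meromorphic (zeta : C -> C) (hzeta : is_Riemann_zeta zeta) t : rmeromorphic (fun s => Re (zeta (RtoC s))) t.
Proof. apply meromorphic_at_real, hzeta. Qed.

Lemma zeta_real_analytic (zeta : C -> C) (hzeta : is_Riemann_zeta zeta) t : t <> 1 -> ranalytic (fun s => Re (zeta (RtoC s))) t.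
Proof.
intro Ht. apply analytic_at_real. apply hzeta. intro E. apply Ht. now apply RtoC_inj.
Qed.

Lemma zeta_real_series (zeta : C -> C) (hzeta : is_Riemann_zeta zeta) s : 1 < s ->
  is_series (fun j => Rpower (INR (S j)) (- s)) (Re (zeta (RtoC s))) /\ Im (zeta (RtoC s)) = 0.
Proof.
intro Hs. destruct hzeta as [_ [_ H]]. specialize (H (RtoC s) Hs).
apply is_series_Re in H. destruct H as [H1 H2]. split.
- eapply is_series_ext; [|exact H1]. intro j. cbv beta.
  rewrite <- RtoC_opp, Cpow_pos_real. reflexivity.
- rewrite <- (is_series_unique _ _ H2).
  rewrite (Series_ext _ (fun j => 0 * 0)); [rewrite Series_scal_l; ring|].
  intro j. rewrite <- RtoC_opp, Cpow_pos_real. simpl. ring.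
Qed.

(** The imaginary part vanishes for large real arguments, hence by the identity theorem on a
    punctured real neighbourhood of [t]. *)
Lemma real_C_derive (f : C -> C) (sg t : R) :
  (forall s, meromorphic_at f s) -> (forall s, sg < s -> Im (f (RtoC s)) = 0) ->
  analytic_at f (RtoC t) -> Im (C_derive f (RtoC t)) = 0.
Proof.
intros Hm Hr Ha.
destruct (rmeromorphic_identity (fun s => Im (f (RtoC s))) (t - 1) sg) with (t := t)
  as [d [Hd Z]]; [|exact Hr|lra|].
- intros s _. apply meromorphic_at_real, Hm.
- destruct (C_derive_jet f t Ha) as [_ J].
  assert (J0 : jet (fun h => Im (f (RtoC (t + h)))) 0 0).
  { apply (jet_ext (fun _ => 0) _ _ _ d Hd); [|apply jet_const].
    intros h Hh. symmetry. apply Z; [lra|]. rewrite Rabs_pos_eq; lra. }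
  exact (proj2 (jet_unique _ _ _ _ _ J J0)).
Qed.

Lemma zeta_derive_jet (zeta : C -> C) (hzeta : is_Riemann_zeta zeta) t : t <> 1 ->
  Im (C_derive zeta (RtoC t)) = 0 /\
  jet (fun h => Re (zeta (RtoC (t + h)))) (Re (zeta (RtoC t))) (Re (C_derive zeta (RtoC t))).
Proof.
intro Ht.
assert (Ha : analytic_at zeta (RtoC t))
  by (apply hzeta; intro E; apply Ht; now apply RtoC_inj).
split; [|apply (C_derive_jet zeta t Ha)].
apply (real_C_derive zeta 1); [apply hzeta| |exact Ha].
intros s Hs. now apply (zeta_real_series zeta hzeta).
Qed.

Lemma Rpower_analytic x t : ranalytic (Rpower x) t.
Proof.
apply (ranalytic_ext (fun s => exp (0 + ln x * s))); [|apply ranalytic_exp].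
intro s. unfold Rpower. f_equal. ring.
Qed.

(** [W] is the Hurwitz zeta function with parameter n + 1/2. It equals (2^s - 1) zeta(s) minus the
    powers of 1/2, ..., n - 1/2, so its continuation is inherited from [zeta]. *)
Lemma shifted_zeta (zeta : C -> C) (hzeta : is_Riemann_zeta zeta) n : (1 <= n)%nat -> exists W : R -> R,
  (forall t, rmeromorphic W t) /\ (forall t, t <> 1 -> ranalytic W t) /\
  (forall s, 1 < s -> is_series (fun j => Rpower (INR j + (INR n + / 2)) (- s)) (W s)).
Proof.
intro Hn.
set (A := fun s => Rpower 2 s + (-1)).
set (B := fun s => (-1) * sum_f_R0 (fun m => Rpower (INR m + / 2) (- s)) (Init.Nat.pred n)).
assert (HA : forall t, ranalytic A t).
{ intro t. apply ranalytic_plus; [apply Rpower_analytic|apply ranalytic_const]. }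
assert (HB : forall t, ranalytic B t).
{ intro t. apply (ranalytic_mult (fun _ => -1)); [apply ranalytic_const|].
  apply ranalytic_sum. intros i _.
  apply (ranalytic_ext (fun s => Rpower (INR i + / 2) (-1 * s + 0))).
  - intro s. f_equal. ring.
  - apply ranalytic_comp_affine; [lra|apply Rpower_analytic]. }
exists (fun s => A s * Re (zeta (RtoC s)) + B s). split; [|split].
- intro t. apply (rmeromorphic_plus (fun s => A s * Re (zeta (RtoC s)))).
  + apply rmeromorphic_mult; [apply ranalytic_rmeromorphic, HA|now apply zeta_real_meromorphic].
  + apply ranalytic_rmeromorphic, HB.
- intros t Ht. apply (ranalytic_plus (fun s => A s * Re (zeta (RtoC s)))); [|apply HB].
  apply ranalytic_mult; [apply HA|now apply zeta_real_analytic].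
- intros s Hs.
  assert (H := half_integer_power_sum _ _ Hs (proj1 (zeta_real_series zeta hzeta s Hs))).
  apply (is_series_ext (fun j => Rpower (INR (n + j) + / 2) (- s))).
  { intro j. f_equal. rewrite plus_INR. ring. }
  apply (is_series_incr_n (K := R_AbsRing) (V := R_NormedModule) (fun j => Rpower (INR j + / 2) (- s)) n); [lia|].
  refine (eq_ind _ (is_series _) H _ _).
  rewrite sum_n_Reals. unfold A, B, plus; simpl. ring_R.
Qed.

(** * The multiplicity polynomial *)

Fixpoint falling (m : nat) (x : R) : R :=
  match m with
  | 0%nat => 1
  | S m' => falling m' x * (x - INR m')
  end.

Lemma fold_right_Rmult_last (l : list R) (c : R) :
  fold_right Rmult 1 (l ++ c :: nil) = fold_right Rmult 1 l * c.
Proof. induction l as [|a l IH]; simpl; [ring|rewrite IH; ring]. Qed.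

Lemma falling_stirling m x :
  sum_f_R0 (fun k => IZR (stirling1 m k) * x ^ k) m = falling m x.
Proof.
rewrite <- sum_n_Reals, stirling1_spec.
induction m as [|m IH]; [reflexivity|].
rewrite seq_S, map_app. simpl map. rewrite fold_right_Rmult_last, IH. reflexivity.
Qed.

Lemma falling_S_l m x : falling (S m) x = x * falling m (x - 1).
Proof.
induction m as [|m IH]; [simpl; ring|].
change (falling (S (S m)) x) with (falling (S m) x * (x - INR (S m))).
rewrite IH, S_INR. simpl falling. ring.
Qed.

Lemma falling_reflect m x : falling m (- x - 1) = (-1) ^ m * falling m (x + INR m).
Proof.
revert x. induction m as [|m IH]; intro x; [simpl; ring|].
rewrite falling_S_l. replace (- x - 1 - 1) with (- (x + 1) - 1) by ring. rewrite IH.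
change (falling (S m) (x + INR (S m))) with
  (falling m (x + INR (S m)) * (x + INR (S m) - INR m)).
rewrite S_INR. replace (x + (INR m + 1)) with (x + 1 + INR m) by ring. simpl pow. ring.
Qed.

Lemma falling_fact m k : falling m (INR (k + m)) * INR (fact k) = INR (fact (k + m)).
Proof.
induction m as [|m IH]; [simpl falling; rewrite Nat.add_0_r; ring|].
rewrite falling_S_l. replace (k + S m)%nat with (S (k + m)) by lia.
replace (INR (S (k + m)) - 1) with (INR (k + m)) by (rewrite S_INR; ring).
rewrite Rmult_assoc, IH, fact_simpl, mult_INR. reflexivity.
Qed.

Lemma falling_zero m j : (j < m)%nat -> falling m (INR j) = 0.
Proof.
induction m as [|m IH]; intro H; [lia|]. simpl.
destruct (Nat.eq_dec j m) as [->|Hne]; [ring|]. rewrite IH by lia. ring.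
Qed.

(* From here on [p = n - 1], so that the sphere is [S^(2 p + 2)]. *)
Definition sphere_mult (p : nat) (X : R) : R :=
  (2 * X + INR (2 * p + 1)) * falling (2 * p) (X + INR (2 * p)) / INR (fact (2 * p + 1)).

Lemma sphere_mult_correct p k :
  sphere_multiplicity (2 * S p) k = sphere_mult p (INR k).
Proof.
unfold sphere_multiplicity, sphere_mult.
replace (2 * k + 2 * S p - 1)%nat with (2 * k + (2 * p + 1))%nat by lia.
replace (k + 2 * S p - 2)%nat with (k + 2 * p)%nat by lia.
replace (2 * S p - 1)%nat with (2 * p + 1)%nat by lia.
rewrite <- plus_INR, <- (falling_fact (2 * p) k), mult_INR, (plus_INR (2 * k)), (mult_INR 2).
assert (H1 := INR_fact_neq_0 k). assert (H2 := INR_fact_neq_0 (2 * p + 1)).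
simpl (INR 2). field. now split.
Qed.

Lemma sphere_mult_0 p : sphere_mult p 0 = 1.
Proof.
unfold sphere_mult. rewrite Rmult_0_r, !Rplus_0_l.
assert (F := falling_fact (2 * p) 0). rewrite Nat.add_0_l in F.
change (INR (fact 0)) with 1 in F. rewrite Rmult_1_r in F. rewrite F.
replace (2 * p + 1)%nat with (S (2 * p)) by lia.
rewrite fact_simpl, mult_INR. field.
split; [apply INR_fact_neq_0|apply not_0_INR; lia].
Qed.

Lemma sphere_mult_nonneg p k : 0 <= sphere_mult p (INR k).
Proof.
unfold sphere_mult. rewrite <- plus_INR.
assert (F := falling_fact (2 * p) k).
assert (H1 := INR_fact_lt_0 k). assert (H2 := INR_fact_lt_0 (2 * p + 1)).
assert (H3 := INR_fact_lt_0 (k + 2 * p)).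
apply Rle_div_r; [exact H2|]. rewrite Rmult_0_l.
pose proof (pos_INR k). pose proof (pos_INR (2 * p + 1)).
apply Rmult_le_pos; [lra|]. apply (Rmult_le_reg_r (INR (fact k))); [exact H1|lra].
Qed.

(** These zeros at -2p, ..., -1 allow a sum over the integers above 2p + 1 to be extended down to 1.
    Only the zero of the argument is left, where the polynomial is 1: it produces log(2n-1). *)
Lemma sphere_mult_shift_0 p j : (1 <= j <= 2 * p)%nat ->
  sphere_mult p (INR j - INR (2 * p + 1)) = 0.
Proof.
intro H. unfold sphere_mult.
replace (INR j - INR (2 * p + 1) + INR (2 * p)) with (INR (j - 1)).
- rewrite falling_zero by lia. unfold Rdiv; ring.
- rewrite minus_INR, plus_INR by lia. simpl (INR 1). ring.
Qed.

(** (2x)^2 - (2i-1)^2 = 4 (x - i + 1/2)(x + i - 1/2), and for i = 1, ..., p these are 2p consecutive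
    factors; the induction adds one at each end. *)
Lemma cfact_odd_product p x :
  fold_right Rmult 1 (map (fun i => (2 * x) ^ 2 - (2 * INR i - 1) ^ 2) (seq 1 p)) =
  4 ^ p * falling (2 * p) (x - / 2 + INR p).
Proof.
induction p as [|p IH]; [simpl; ring|].
rewrite seq_S, map_app. cbn [map]. rewrite fold_right_Rmult_last, IH.
replace (2 * S p)%nat with (S (S (2 * p))) by lia. rewrite falling_S_l.
replace (x - / 2 + INR (S p) - 1) with (x - / 2 + INR p) by (rewrite S_INR; ring).
change (falling (S (2 * p)) (x - / 2 + INR p)) with
  (falling (2 * p) (x - / 2 + INR p) * (x - / 2 + INR p - INR (2 * p))).
rewrite mult_INR. simpl (INR 2). change (1 + p)%nat with (S p). rewrite !S_INR. simpl (4 ^ S p). field.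
Qed.

Lemma sphere_mult_cfact p X : 0 < X + INR p + / 2 ->
  sphere_mult p X = sum_f_R0 (fun i => cfact_odd_bar (S p) (S i) *
     (2 * (X + INR p + / 2)) ^ (2 * i + 1)) p.
Proof.
intro Hx. set (x := X + INR p + / 2) in *.
(* The central factorial polynomial taken at (2x)^2 has even powers of 2x, the multiplicity odd
   ones; hence this factor. *)
apply (Rmult_eq_reg_l (2 * x)); [|lra].
assert (H := cfact_odd_spec (S p) ((2 * x) ^ 2) ltac:(lia)).
replace (S p - 1)%nat with p in H by lia. rewrite cfact_odd_product in H.
rewrite <- sum_n_m_S in H.
change (sum_n (fun k => IZR (cfact_odd (S p) (S k)) * ((2 * x) ^ 2) ^ S k) p =
  (2 * x) ^ 2 * (4 ^ p * falling (2 * p) (x - / 2 + INR p))) in H.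
rewrite sum_n_Reals in H. rewrite scal_sum.
rewrite (sum_eq _ (fun i => (IZR (cfact_odd (S p) (S i)) * ((2 * x) ^ 2) ^ S i) *
   (/ 4 ^ p / INR (fact (2 * p + 1))))).
- rewrite <- scal_sum, H. unfold sphere_mult.
  replace (X + INR (2 * p)) with (x - / 2 + INR p)
    by (unfold x; rewrite mult_INR; simpl (INR 2); ring).
  replace (2 * X + INR (2 * p + 1)) with (2 * x)
    by (unfold x; rewrite plus_INR, mult_INR; simpl INR; field).
  field. split; [apply pow_nonzero; lra|apply INR_fact_neq_0].
- intros i _. unfold cfact_odd_bar.
  replace (2 * S p - 1)%nat with (2 * p + 1)%nat by lia.
  replace (S p - 1)%nat with p by lia. rewrite <- pow_mult.
  replace (2 * S i)%nat with (S (2 * i + 1)) by lia. rewrite <- tech_pow_Rmult. unfold Rdiv. ring.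
Qed.

Lemma sum_even_part (c : nat -> R) X N :
  sum_f_R0 (fun m => c m * (X ^ m + (- X) ^ m)) (2 * N) =
  2 * sum_f_R0 (fun k => c (2 * k)%nat * X ^ (2 * k)) N.
Proof.
assert (O : forall k, (- X) ^ (2 * k) = X ^ (2 * k))
  by (intro k; rewrite !pow_mult; f_equal; ring).
induction N as [|N IH]; [simpl; ring|].
rewrite tech5. replace (2 * S N)%nat with (S (S (2 * N))) by lia. rewrite !tech5, IH.
replace (S (S (2 * N))) with (2 * S N)%nat by lia. rewrite O, <- !tech_pow_Rmult, O. ring.
Qed.

Lemma sum_odd_part (c : nat -> R) X N :
  sum_f_R0 (fun m => c m * (X ^ S m + (- X) ^ S m)) (2 * N + 1) =
  2 * sum_f_R0 (fun k => c (2 * k + 1)%nat * X ^ (2 * k + 2)) N.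
Proof.
assert (O : forall k, (- X) ^ (2 * k) = X ^ (2 * k))
  by (intro k; rewrite !pow_mult; f_equal; ring).
induction N as [|N IH]; [simpl; ring|].
rewrite (tech5 _ N). replace (2 * S N + 1)%nat with (S (S (2 * N + 1))) by lia.
rewrite !tech5, IH.
replace (S (S (2 * N + 1))) with (S (2 * S N)) by lia.
replace (S (2 * N + 1)) with (2 * S N)%nat by lia.
replace (2 * S N + 2)%nat with (2 * S (S N))%nat by lia.
replace (S (S (2 * S N))) with (2 * S (S N))%nat by lia.
rewrite O, <- !tech_pow_Rmult, O.
replace (2 * S N + 1)%nat with (S (2 * S N)) by lia. ring.
Qed.

Definition zeta_coef (p k : nat) : R :=
  2 / INR (fact (2 * p + 1)) *
  IZR (stirling1 (2 * p + 1) (2 * k + 1) + stirling1 (2 * p + 2) (2 * k + 2)).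

(** Writing 2Y - b = Y + (Y - b) turns Y G(Y) into Y (Y)_b + (Y)_(b+1), with falling factorials. Up
    to the factor 1/b!, the two values of [sphere_mult] are -G(-X), by reflection, and G(X). So X
    times the left side is twice the even part of this polynomial over b!, and its coefficients are
    sums of two Stirling numbers. *)
Lemma sphere_mult_shift_sum p X : X <> 0 ->
  sphere_mult p X + sphere_mult p (X - INR (2 * p + 1)) =
  sum_f_R0 (fun k => zeta_coef p k * X ^ (2 * k + 1)) p.
Proof.
intro HX. set (b := (2 * p + 1)%nat).
set (G := fun Y => (2 * Y - INR b) * falling (2 * p) (Y - 1)).
assert (HG : forall Y, Y * G Y = Y * falling b Y + falling (2 * p + 2) Y).
{ intro Y. unfold G. replace (2 * p + 2)%nat with (S b) by (unfold b; lia).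
  change (falling (S b) Y) with (falling b Y * (Y - INR b)).
  unfold b at 2 3. replace (2 * p + 1)%nat with (S (2 * p)) by lia. rewrite falling_S_l. ring. }
assert (E1 : sphere_mult p (X - INR b) = G X / INR (fact b)).
{ unfold sphere_mult, G. fold b.
  replace (X - INR b + INR (2 * p)) with (X - 1)
    by (unfold b; rewrite plus_INR; simpl (INR 1); ring).
  f_equal. ring. }
assert (E2 : sphere_mult p X = - G (- X) / INR (fact b)).
{ unfold sphere_mult, G. fold b. rewrite falling_reflect, pow_1_even. unfold Rdiv. ring. }
rewrite E1, E2. apply (Rmult_eq_reg_l X); [|exact HX].
replace (X * (- G (- X) / INR (fact b) + G X / INR (fact b)))
  with ((X * G X + (- X) * G (- X)) / INR (fact b))
  by (field; apply INR_fact_neq_0).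
rewrite !HG.
assert (S1 : X * falling b X + - X * falling b (- X) =
  2 * sum_f_R0 (fun k => IZR (stirling1 b (2 * k + 1)) * X ^ (2 * k + 2)) p).
{ rewrite <- (sum_odd_part (fun m => IZR (stirling1 b m))). fold b.
  rewrite <- !falling_stirling, !scal_sum, <- plus_sum. apply sum_eq.
  intros i _. simpl pow. ring. }
assert (S2 : falling (2 * p + 2) X + falling (2 * p + 2) (- X) =
  2 * sum_f_R0 (fun k => IZR (stirling1 (2 * p + 2) (2 * k + 2)) * X ^ (2 * k + 2)) p).
{ assert (Q := sum_even_part (fun m => IZR (stirling1 (2 * p + 2) m)) X (S p)).
  replace (2 * S p)%nat with (2 * p + 2)%nat in Q by lia.
  rewrite (decomp_sum _ (S p)) in Q by lia. simpl Init.Nat.pred in Q.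
  (* The constant coefficient is 0, because 0 is among the roots; the even powers thus start at
     [X ^ 2]. *)
  replace (stirling1 (2 * p + 2) (2 * 0)) with 0%Z in Q
    by (replace (2 * p + 2)%nat with (S (2 * p + 1)) by lia; reflexivity).
  rewrite Rmult_0_l, Rplus_0_l in Q.
  rewrite (sum_eq (fun k => _ * X ^ (2 * k + 2)) (fun i =>
     IZR (stirling1 (2 * p + 2) (2 * S i)) * X ^ (2 * S i)))
    by (intros i _; replace (2 * S i)%nat with (2 * i + 2)%nat by lia; reflexivity).
  rewrite <- Q, <- !falling_stirling, <- plus_sum. apply sum_eq. intros i _. ring. }
replace (X * falling b X + falling (2 * p + 2) X +
  (- X * falling b (- X) + falling (2 * p + 2) (- X)))
  with ((X * falling b X + - X * falling b (- X)) +
        (falling (2 * p + 2) X + falling (2 * p + 2) (- X))) by ring.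
rewrite S1, S2, <- Rmult_plus_distr_l, <- plus_sum.
unfold Rdiv. rewrite Rmult_assoc, Rmult_comm, Rmult_assoc, Rmult_comm, Rmult_assoc, !scal_sum.
apply sum_eq. intros i _. unfold zeta_coef. fold b. rewrite plus_IZR.
replace (2 * i + 2)%nat with (S (2 * i + 1)) by lia. rewrite <- tech_pow_Rmult. unfold Rdiv. ring.
Qed.

(** * Expansion of the remaining part *)

(* [l]-th term of the expansion in [a / x] of
   [x ^ q * ((x ^ 2 - a ^ 2) ^ (- s) - (x - a) ^ (- s) - (x + a) ^ (- s))]. *)
Definition eterm (a q : R) (l : nat) (x s : R) : R :=
  a ^ (2 * l) * (negbin l s * Rpower x (q - 2 * s - 2 * INR l) +
                 (-2) * (negbin (2 * l) s * Rpower x (q - s - 2 * INR l))).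

Lemma Rpower_shift_down x y l : 0 < x -> Rpower x (y - 2 * INR l) = Rpower x y / x ^ (2 * l).
Proof.
intro Hx. unfold Rminus. rewrite Rpower_plus, Rpower_Ropp.
rewrite <- (Rpower_pow (2 * l) x Hx), mult_INR. reflexivity.
Qed.

Lemma eterm_series a q x s : 0 < a < x -> 0 < s ->
  is_series (fun l => eterm a q l x s)
    (Rpower x q * (Rpower (x ^ 2 - a ^ 2) (- s) - Rpower (x - a) (- s) - Rpower (x + a) (- s))).
Proof.
intros Ha Hs. set (y := a / x).
assert (Hy : 0 < y < 1).
{ unfold y. split; [apply Rdiv_lt_0_compat; lra|]. apply Rlt_div_l; lra. }
assert (Hy2 : 0 < y ^ 2 < 1) by nra.
assert (F1 := negbin_series s (y ^ 2) Hs ltac:(rewrite Rabs_pos_eq; lra)).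
assert (F2 := negbin_even_series s y Hs ltac:(lra)).
assert (G := is_series_plus _ _ _ _
  (is_series_scal_l (Rpower x (q - 2 * s)) _ _ F1)
  (is_series_scal_l (- Rpower x (q - s)) _ _ F2)).
replace (Rpower x q * (Rpower (x ^ 2 - a ^ 2) (- s) - Rpower (x - a) (- s) - Rpower (x + a) (- s)))
  with (Rpower x (q - 2 * s) * Rpower (1 - y ^ 2) (- s) +
        - Rpower x (q - s) * (Rpower (1 - y) (- s) + Rpower (1 + y) (- s))).
- eapply is_series_ext; [|exact G]. intro l. unfold plus, scal; simpl; unfold mult; simpl.
  change (l + (l + 0))%nat with (2 * l)%nat.
  change (y * (y * 1)) with (y ^ 2).
  unfold eterm. rewrite !Rpower_shift_down by lra. rewrite <- pow_mult.
  unfold y at 1 2, Rdiv. rewrite !Rpow_mult_distr, pow_inv.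
  assert (x ^ (2 * l) <> 0) by (apply pow_nonzero; lra). field_R. exact H.
- replace (x ^ 2 - a ^ 2) with (x ^ 2 * (1 - y ^ 2)) by (unfold y; field; lra).
  replace (x - a) with (x * (1 - y)) by (unfold y; field; lra).
  replace (x + a) with (x * (1 + y)) by (unfold y; field; lra).
  rewrite <- !Rpower_mult_distr by nra.
  replace (Rpower (x ^ 2) (- s)) with (Rpower x (- (2 * s))).
  + unfold Rminus. rewrite !(Rpower_plus q). ring.
  + rewrite <- (Rpower_pow 2 x) by lra. rewrite Rpower_mult. f_equal. simpl. ring.
Qed.

Lemma Rpower_wiener x u v t rho M : 0 <= rho -> 0 < x ->
  Rpower x (u + v * t) * exp (Rabs (v * ln x) * rho) <= M ->
  wiener rho M (fun h => Rpower x (u + v * (t + h))).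
Proof.
intros Hr Hx HM.
apply (wiener_ext _ _ (fun h => exp ((u + v * t) * ln x + (v * ln x) * h))).
- intros h _. unfold Rpower. f_equal. ring.
- eapply wiener_le; [|exact HM|]; [split; [exact Hr|apply Rle_refl]|].
  unfold Rpower. rewrite <- exp_plus. now apply wiener_exp.
Qed.

Lemma exp_nondecreasing x y : x <= y -> exp x <= exp y.
Proof. intros [H| ->]; [left; now apply exp_increasing|right; reflexivity]. Qed.

(** For t >= -1/2 and |h| <= 1/2 the argument t + h is at least -1, so the exponents -2(t+h) and
    -(t+h) are at most 2. This is the 2 in [q + 2 - 2 * INR l]. *)
Lemma eterm_wiener a q l x t : 0 < a -> 1 <= x -> - (1 / 2) <= t ->
  wiener (1 / 2)
    (a ^ (2 * l) * Rpower x (q + 2 - 2 * INR l) *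
       (negbin l (Rabs t + 1 / 2) + 2 * negbin (2 * l) (Rabs t + 1 / 2)))
    (fun h => eterm a q l x (t + h)).
Proof.
intros Ha Hx Ht. set (T := Rabs t + 1 / 2). set (K := Rpower x (q + 2 - 2 * INR l)).
assert (HT : 0 < T) by (unfold T; pose proof (Rabs_pos t); lra).
assert (Hln : 0 <= ln x).
{ rewrite <- ln_1. destruct Hx as [Hx|<-]; [left; apply ln_increasing; lra|right; reflexivity]. }
assert (W : forall m v, 0 <= v <= 2 -> wiener (1 / 2) (negbin m T * K)
  (fun h => negbin m (t + h) * Rpower x (q - 2 * INR l + - v * (t + h)))).
{ intros m v Hv. apply (wiener_mult _ _ _ (fun h => negbin m (t + h))); [lra|apply negbin_wiener; lra|].
  apply Rpower_wiener; [lra|lra|].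
  rewrite Rabs_mult, Rabs_Ropp, (Rabs_pos_eq v), (Rabs_pos_eq (ln x)) by lra.
  unfold K, Rpower. rewrite <- exp_plus. apply exp_nondecreasing.
  replace ((q - 2 * INR l + - v * t) * ln x + v * ln x * (1 / 2))
    with ((q - 2 * INR l + v * (1 / 2 - t)) * ln x) by field.
  apply Rmult_le_compat_r; [exact Hln|]. nra. }
apply (wiener_le (1 / 2) _ (Rabs (a ^ (2 * l)) * (negbin l T * K + Rabs (-2) * (negbin (2 * l) T * K)))).
- lra.
- rewrite (Rabs_pos_eq (a ^ _)) by (apply pow_le; lra).
  rewrite (Rabs_left (-2)) by lra. right; ring.
- unfold eterm. apply wiener_scal.
  apply (wiener_plus (1 / 2) _ _
    (fun h => negbin l (t + h) * Rpower x (q - 2 * (t + h) - 2 * INR l))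
    (fun h => -2 * (negbin (2 * l) (t + h) * Rpower x (q - (t + h) - 2 * INR l)))); [lra| |].
  + eapply wiener_ext; [|exact (W l 2 ltac:(lra))].
    intros h _. cbv beta. do 2 f_equal. ring.
  + apply wiener_scal. eapply wiener_ext; [|exact (W (2 * l)%nat 1 ltac:(lra))].
    intros h _. cbv beta. do 2 f_equal. ring.
Qed.

Lemma Rpower_jet x u v : exists c, jet (fun h => Rpower x (u + v * h)) (Rpower x u) c.
Proof.
destruct (ranalytic_jet (fun h => exp (u * ln x + (v * ln x) * h)) 0 (ranalytic_exp _ _ _))
  as [c [J _]].
exists c. replace (Rpower x u) with (exp (u * ln x + (v * ln x) * 0)) by (unfold Rpower; f_equal; ring).
apply (jet_ext (fun h => exp (u * ln x + (v * ln x) * (0 + h))) _ _ _ 1 Rlt_0_1); [|exact J].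
intros h _. unfold Rpower. f_equal. ring.
Qed.

(** Both binomial coefficients vanish at 0, with derivatives 1/(l+1) and 1/(2l+2). The factor -2
    makes the two first-order terms cancel, as both powers of [x] agree at 0. *)
Lemma eterm_flat a q l x : jet (eterm a q (S l) x) 0 0.
Proof.
destruct (negbin_zero_factor l) as [p1 [E1 J1]].
destruct (negbin_zero_factor (2 * l + 1)) as [p2 [E2 J2]].
destruct (Rpower_jet x (q - 2 * INR (S l)) (-2)) as [c1 K1].
destruct (Rpower_jet x (q - 2 * INR (S l)) (-1)) as [c2 K2].
assert (J := jet_mult _ _ _ _ _ _ (jet_scal (a ^ (2 * S l)) _ _ _ (jet_affine 0 1))
  (jet_plus _ _ _ _ _ _ (jet_mult _ _ _ _ _ _ J1 K1)
    (jet_scal (-2) _ _ _ (jet_mult _ _ _ _ _ _ J2 K2)))).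
assert (Z : / INR (S l) * Rpower x (q - 2 * INR (S l)) +
  -2 * (/ INR (S (2 * l + 1)) * Rpower x (q - 2 * INR (S l))) = 0).
{ replace (S (2 * l + 1)) with (2 * S l)%nat by lia. rewrite mult_INR. simpl (INR 2).
  field. apply not_0_INR; lia. }
rewrite Z in J. rewrite !Rmult_0_r, Rmult_0_l, Rplus_0_l in J.
apply (jet_ext _ (eterm a q (S l) x) _ _ 1 Rlt_0_1) in J; [exact J|].
intros h _. unfold eterm. replace (2 * S l)%nat with (S (2 * l + 1)) at 3 by lia.
rewrite E1, E2.
replace (q - 2 * h - 2 * INR (S l)) with (q - 2 * INR (S l) + -2 * h) by ring.
replace (q - h - 2 * INR (S l)) with (q - 2 * INR (S l) + -1 * h) by ring. ring.
Qed.

Section Remainder.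

(** The condition on [d] makes the exponent q + 2 - 2d at most -2, which gives convergence over [x].
    As the smallest [x] is 1 + a, the ratio a/x stays below 1, which gives convergence over [l]. *)
Context (a q : R) (d : nat) (Ha : 0 < a) (Hd : q + 4 <= 2 * INR d) (Hd1 : (1 <= d)%nat).

Let x (j : nat) := INR j + (1 + a).

Definition inner_remainder (j : nat) (s : R) : R := Series (fun m => eterm a q (d + m) (x j) s).

Definition remainder (s : R) : R := Series (fun j => inner_remainder j s).

Let y0 := a / (1 + a).

Let coef (t : R) (l : nat) :=
  y0 ^ (2 * l) * (negbin l (Rabs t + 1 / 2) + 2 * negbin (2 * l) (Rabs t + 1 / 2)).

Let y0_bounds : 0 < y0 < 1.
Proof.
unfold y0. split; [apply Rdiv_lt_0_compat; lra|]. apply Rlt_div_l; lra.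
Qed.

Let x_ge j : 1 + a <= x j.
Proof. unfold x. pose proof (pos_INR j). lra. Qed.

Let T_pos t : 0 < Rabs t + 1 / 2.
Proof. pose proof (Rabs_pos t). lra. Qed.

Let coef_summable t : ex_series (coef t).
Proof.
assert (Y := y0_bounds).
assert (E1 := negbin_abs_series (Rabs t + 1 / 2) (y0 ^ 2) (T_pos t) ltac:(nra)).
assert (E2' := ex_intro (fun l => is_series _ l) _ (negbin_even_series (Rabs t + 1 / 2) y0 (T_pos t) ltac:(lra))).
assert (E := ex_series_plus (K := R_AbsRing) (V := R_NormedModule) _ _ E1 E2').
eapply ex_series_ext; [|exact E]. intro l. unfold coef, plus; simpl.
change (l + (l + 0))%nat with (2 * l)%nat. change (y0 * (y0 * 1)) with (y0 ^ 2).
rewrite <- pow_mult. ring_R.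
Qed.

(** A product of a function of [j] and a function of [m], so that the double sum splits. Of the
    2(d+m) factors a/x, the first 2d are spent on the decay x^(-2) and the others are bounded by
    [y0]; dividing by [y0 ^ (2 * d)] compensates for the full power of [y0] in [coef]. *)
Let bound (t : R) (j m : nat) := (/ y0 ^ (2 * d) * a ^ (2 * d) * Rpower (x j) (- (2))) * coef t (d + m).

Let term_wiener t j m : - (1 / 2) <= t ->
  wiener (1 / 2) (bound t j m) (fun h => eterm a q (d + m) (x j) (t + h)).
Proof.
intro Ht. assert (Hx := x_ge j). assert (Y := y0_bounds).
eapply wiener_le; [| |apply (eterm_wiener a q (d + m) (x j) t Ha ltac:(lra) Ht)]; [lra|].
unfold bound, coef. rewrite <- !Rmult_assoc. apply Rmult_le_compat_r.
{ pose proof (negbin_pos (d + m) _ (T_pos t)). pose proof (negbin_pos (2 * (d + m)) _ (T_pos t)). lra. }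
replace (2 * (d + m))%nat with (2 * d + 2 * m)%nat by lia. rewrite !pow_add, plus_INR.
assert (P1 : 0 < y0 ^ (2 * d)) by (apply pow_lt; lra).
replace (/ y0 ^ (2 * d) * a ^ (2 * d) * Rpower (x j) (- (2)) * (y0 ^ (2 * d) * y0 ^ (2 * m)))
  with (a ^ (2 * d) * (Rpower (x j) (- (2)) * y0 ^ (2 * m))) by (field; lra).
rewrite Rmult_assoc. apply Rmult_le_compat_l; [apply pow_le; lra|].
replace (q + 2 - 2 * (INR d + INR m)) with (q + 2 - 2 * INR d - 2 * INR m) by ring.
rewrite Rpower_shift_down by lra.
replace (a ^ (2 * m) * (Rpower (x j) (q + 2 - 2 * INR d) / x j ^ (2 * m)))
  with (Rpower (x j) (q + 2 - 2 * INR d) * (a / x j) ^ (2 * m))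
  by (unfold Rdiv; rewrite Rpow_mult_distr, pow_inv; ring).
apply Rmult_le_compat.
- left; apply Rpower_pos.
- apply pow_le. left. apply Rdiv_lt_0_compat; lra.
- apply Rle_Rpower; lra.
- apply pow_incr. split; [left; apply Rdiv_lt_0_compat; lra|].
  unfold y0, Rdiv. apply Rmult_le_compat_l; [lra|]. apply Rinv_le_contravar; lra.
Qed.

Let bound_summable t j : ex_series (bound t j).
Proof.
apply (ex_series_scal_l (K := R_AbsRing) _ (fun m => coef t (d + m))).
apply (ex_series_incr_n (K := R_AbsRing) (V := R_NormedModule) (coef t) d), coef_summable.
Qed.

Lemma inner_remainder_wiener t j : - (1 / 2) <= t ->
  wiener (1 / 2) (Series (bound t j)) (fun h => inner_remainder j (t + h)).
Proof.
intro Ht. apply (wiener_sum (1 / 2) (bound t j) (fun m h => eterm a q (d + m) (x j) (t + h))); [lra| |].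
- intro m. now apply term_wiener.
- apply bound_summable.
Qed.

Lemma inner_bound_summable t : ex_series (fun j => Series (bound t j)).
Proof.
apply (ex_series_ext (fun j => (Series (fun m => coef t (d + m)) * (/ y0 ^ (2 * d) * a ^ (2 * d))) * Rpower (x j) (- (2)))).
- intro j. unfold bound. rewrite Series_scal_l. ring_R.
- apply (ex_series_scal_l (K := R_AbsRing) _ (fun j => Rpower (x j) (- (2)))).
  apply ex_series_power; lra.
Qed.

Lemma remainder_analytic t : - (1 / 2) <= t -> ranalytic remainder t.
Proof.
intro Ht. exists (1 / 2), (Series (fun j => Series (bound t j))). split; [lra|].
apply (wiener_sum (1 / 2) _ (fun j h => inner_remainder j (t + h))); [lra| |].
- intro j. now apply inner_remainder_wiener.
- apply inner_bound_summable.
Qed.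

Lemma remainder_summable s : - (1 / 2) <= s -> ex_series (fun j => inner_remainder j s).
Proof.
intro Hs. apply (ex_series_le (K := R_AbsRing) (V := R_CompleteNormedModule) _ _) with (2 := inner_bound_summable s).
intro j. replace s with (s + 0) at 1 by ring.
apply (wiener_bound _ _ _ 0 (inner_remainder_wiener s j Hs)). rewrite Rabs_R0; lra.
Qed.

Lemma remainder_flat : jet remainder 0 0.
Proof.
apply (jet_sum_flat (1 / 2) (fun j => Series (bound 0 j)) inner_remainder); [lra| | |apply inner_bound_summable].
- intro j. apply (wiener_ext _ _ (fun h => inner_remainder j (0 + h))).
  + intros h _. now rewrite Rplus_0_l.
  + apply inner_remainder_wiener; lra.
- intro j. apply (jet_sum_flat (1 / 2) (bound 0 j) (fun m => eterm a q (d + m) (x j))); [lra| | |apply bound_summable].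
  + intro m. apply (wiener_ext _ _ (fun h => eterm a q (d + m) (x j) (0 + h))).
    * intros h _. now rewrite Rplus_0_l.
    * apply term_wiener; lra.
  (* As [d] is at least 1, the term l = 0 does not occur; its value at 0 is -x^q, not 0. *)
  + intro m. destruct d as [|d']; [lia|]. apply eterm_flat.
Qed.

Lemma inner_remainder_value j s : 0 < s ->
  Rpower (x j) q * (Rpower (x j ^ 2 - a ^ 2) (- s) - Rpower (x j - a) (- s) - Rpower (x j + a) (- s))
  = sum_f_R0 (fun l => eterm a q l (x j) s) (Init.Nat.pred d) + inner_remainder j s.
Proof.
intro Hs. assert (Hx := x_ge j).
assert (H := eterm_series a q (x j) s ltac:(lra) Hs).
rewrite <- (is_series_unique _ _ H). apply Series_incr_n; [lia|eexists; exact H].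
Qed.

End Remainder.

Lemma is_series_sum_f_R0 (u : nat -> nat -> R) (v : nat -> R) N :
  (forall l, (l <= N)%nat -> is_series (u l) (v l)) ->
  is_series (fun j => sum_f_R0 (fun l => u l j) N) (sum_f_R0 v N).
Proof.
induction N as [|N IH]; intro H; simpl; [now apply H|].
apply (is_series_plus (fun j => sum_f_R0 (fun l => u l j) N) (u (S N))); [|now apply H].
apply IH. intros; apply H; lia.
Qed.

(* Sum over [x = 1 + a, 2 + a, ...] of the terms [l <= N] of [eterm], where [W]
   is the continuation of the sum of the [x ^ (- s)]. *)
Definition main_part (a q : R) (W : R -> R) (N : nat) (s : R) : R :=
  sum_f_R0 (fun l => a ^ (2 * l) *
    (negbin l s * W (2 * s + (2 * INR l - q)) +
     (-2) * (negbin (2 * l) s * W (1 * s + (2 * INR l - q))))) N.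

Lemma main_part_meromorphic a q W N t :
  (forall s, rmeromorphic W s) -> rmeromorphic (main_part a q W N) t.
Proof.
intro HW. apply rmeromorphic_sum. intros l _.
apply (rmeromorphic_mult (fun _ => a ^ (2 * l))); [apply rmeromorphic_const|].
apply (rmeromorphic_plus (fun s => negbin l s * W (2 * s + (2 * INR l - q)))).
- apply (rmeromorphic_mult (negbin l)); [apply ranalytic_rmeromorphic, negbin_ranalytic|].
  apply rmeromorphic_comp_affine; [lra|apply HW].
- apply (rmeromorphic_mult (fun _ => -2)); [apply rmeromorphic_const|].
  apply (rmeromorphic_mult (negbin (2 * l))); [apply ranalytic_rmeromorphic, negbin_ranalytic|].
  apply rmeromorphic_comp_affine; [lra|apply HW].
Qed.

(** The condition 1 + q < s is what the term l = 0 needs for W(s - q) to be the sum of its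
    series. *)
Lemma expansion_sum a q d (W : R -> R) s : 0 < a -> q + 4 <= 2 * INR d -> (1 <= d)%nat ->
  0 < s -> 1 + q < s ->
  (forall s, 1 < s -> is_series (fun j => Rpower (INR j + (1 + a)) (- s)) (W s)) ->
  is_series (fun j => let x := INR j + (1 + a) in
      Rpower x q * (Rpower (x ^ 2 - a ^ 2) (- s) - Rpower (x - a) (- s) - Rpower (x + a) (- s)))
    (main_part a q W (Init.Nat.pred d) s + remainder a q d s).
Proof.
intros Ha Hd Hd1 Hs Hqs HW.
assert (T : forall l, is_series (fun j => eterm a q l (INR j + (1 + a)) s)
  (a ^ (2 * l) * (negbin l s * W (2 * s + (2 * INR l - q)) +
     (-2) * (negbin (2 * l) s * W (1 * s + (2 * INR l - q)))))).
{ intro l. pose proof (pos_INR l).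
  assert (G := is_series_scal_l (a ^ (2 * l)) _ _ (is_series_plus _ _ _ _
    (is_series_scal_l (negbin l s) _ _ (HW (2 * s + (2 * INR l - q)) ltac:(lra)))
    (is_series_scal_l (-2) _ _ (is_series_scal_l (negbin (2 * l) s) _ _
       (HW (1 * s + (2 * INR l - q)) ltac:(lra)))))).
  eapply is_series_ext; [|exact G]. intro j. unfold eterm, scal, plus, mult; simpl.
  unfold mult; simpl. change (l + (l + 0))%nat with (2 * l)%nat.
  replace (- (2 * s + (2 * INR l - q))) with (q - 2 * s - 2 * INR l) by ring.
  replace (- (1 * s + (2 * INR l - q))) with (q - s - 2 * INR l) by ring. ring_R. }
assert (M := is_series_sum_f_R0 (fun l j => eterm a q l (INR j + (1 + a)) s) _ (Init.Nat.pred d) (fun l _ => T l)).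
assert (Rm := Series_correct _ (remainder_summable a q d Ha Hd Hd1 s ltac:(lra))).
eapply is_series_ext; [|exact (is_series_plus _ _ _ _ M Rm)].
intro j. cbv beta zeta. rewrite (inner_remainder_value a q d Ha Hd1 j s Hs). reflexivity.
Qed.

(** * Derivatives at 0 of the terms of the expansion *)

Definition slope (u : R -> R) (c : R) : Prop := exists c0, jet u c0 c.

Lemma slope_plus u v c d : slope u c -> slope v d -> slope (fun h => u h + v h) (c + d).
Proof.
intros [c0 J] [d0 K]. exists (c0 + d0). now apply jet_plus.
Qed.

Lemma slope_scal k u c : slope u c -> slope (fun h => k * u h) (k * c).
Proof. intros [c0 J]. exists (k * c0). now apply jet_scal. Qed.

Lemma slope_sum (u : nat -> R -> R) (c : nat -> R) N :
  (forall i, (i <= N)%nat -> slope (u i) (c i)) ->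
  slope (fun h => sum_f_R0 (fun i => u i h) N) (sum_f_R0 c N).
Proof.
induction N as [|N IH]; intro H; simpl; [now apply H|].
apply (slope_plus (fun h => sum_f_R0 (fun i => u i h) N)); [|now apply H].
apply IH. intros; apply H; lia.
Qed.

Lemma sum_single (k N : nat) v : (k <= N)%nat ->
  sum_f_R0 (fun l => if Nat.eqb l k then v else 0) N = v.
Proof.
assert (Z : forall M, (M < k)%nat -> sum_f_R0 (fun l => if Nat.eqb l k then v else 0) M = 0).
{ induction M as [|M IH]; intro H.
  - simpl. destruct k; [lia|reflexivity].
  - rewrite tech5, IH by lia. destruct (Nat.eqb_spec (S M) k); [lia|ring]. }
induction N as [|N IH]; intro H.
- replace k with 0%nat by lia. reflexivity.
- rewrite tech5. destruct (Nat.eqb_spec (S N) k) as [E|E].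
  + rewrite Z by lia. ring.
  + rewrite IH by lia. ring.
Qed.

Lemma jet_shift_comp (W : R -> R) (c w : R) : 0 < c -> ranalytic W w ->
  exists g, jet (fun h => W (c * h + w)) (W w) (c * g) /\ jet (fun h => W (1 * h + w)) (W w) g.
Proof.
intros Hc HW. destruct (ranalytic_jet W w HW) as [g [J _]]. exists g. split.
- apply (jet_ext (fun h => W (w + c * h)) _ _ _ 1 Rlt_0_1).
  + intros h _. f_equal. ring.
  + now apply (jet_dilate (fun h => W (w + h))).
- apply (jet_ext (fun h => W (w + h)) _ _ _ 1 Rlt_0_1); [|exact J].
  intros h _. f_equal. ring.
Qed.

(** For l = 0 the derivative is 2 W'(w) - 2 W'(w). For l > 0 the binomial coefficients vanish at 0
    with derivatives 1/l and 1/(2l), so that W(w)/l cancels against 2 W(w)/(2l). *)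
Lemma regular_term_slope W l w : ranalytic W w ->
  slope (fun s => negbin l s * W (2 * s + w) + (-2) * (negbin (2 * l) s * W (1 * s + w))) 0.
Proof.
intro HW. destruct (jet_shift_comp W 2 w ltac:(lra) HW) as [g [J1 J2]].
destruct l as [|l].
- exists (W w + -2 * W w).
  assert (J := jet_plus _ _ _ _ _ _ J1 (jet_scal (-2) _ _ _ J2)).
  replace (2 * g + -2 * g) with 0 in J by ring.
  apply (jet_ext _ (fun s => negbin 0 s * W (2 * s + w) + -2 * (negbin (2 * 0) s * W (1 * s + w))) _ _ 1 Rlt_0_1) in J;
    [exact J|]. intros h _. simpl. ring.
- destruct (negbin_zero_factor l) as [p1 [E1 K1]].
  destruct (negbin_zero_factor (2 * l + 1)) as [p2 [E2 K2]].
  exists 0.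
  assert (J := jet_mult _ _ _ _ _ _ (jet_affine 0 1)
    (jet_plus _ _ _ _ _ _ (jet_mult _ _ _ _ _ _ K1 J1)
      (jet_scal (-2) _ _ _ (jet_mult _ _ _ _ _ _ K2 J2)))).
  assert (Z : / INR (S l) * W w + -2 * (/ INR (S (2 * l + 1)) * W w) = 0).
  { replace (S (2 * l + 1)) with (2 * S l)%nat by lia. rewrite mult_INR. simpl (INR 2).
    field. apply not_0_INR; lia. }
  rewrite Z, !Rmult_0_l, Rmult_0_r, Rplus_0_l in J.
  apply (jet_ext _ (fun s => negbin (S l) s * W (2 * s + w) + -2 * (negbin (2 * S l) s * W (1 * s + w))) _ _ 1 Rlt_0_1) in J;
    [exact J|].
  intros h _. replace (2 * S l)%nat with (S (2 * l + 1)) by lia. rewrite E1, E2. ring.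
Qed.

(** The pole cancels the simple zeros, so the second-order coefficients of [negbin] become visible.
    The residue at 0 is 1/2 for W(2s+1) and 1 for W(s+1), whence the H_l/2 against H_(2l+1); [g] has
    weight 1/(l+1) in both products and drops out. *)
Lemma polar_term_slope W l g : jet (fun h => h * W (1 + h)) 1 g ->
  slope (fun s => negbin (S l) s * W (2 * s + 1) + (-2) * (negbin (2 * S l) s * W (1 * s + 1)))
    (/ INR (S l) * (harmonic l / 2 - harmonic (2 * l + 1))).
Proof.
intro HW.
destruct (negbin_zero_factor l) as [p1 [E1 K1]].
destruct (negbin_zero_factor (2 * l + 1)) as [p2 [E2 K2]].
assert (H2 := jet_scal (/ 2) _ _ _ (jet_dilate _ 2 _ _ ltac:(lra) HW)).
assert (J := jet_plus _ _ _ _ _ _ (jet_mult _ _ _ _ _ _ K1 H2)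
      (jet_scal (-2) _ _ _ (jet_mult _ _ _ _ _ _ K2 HW))).
eexists.
apply (jet_ext _ (fun s => negbin (S l) s * W (2 * s + 1) + -2 * (negbin (2 * S l) s * W (1 * s + 1))) _ _ 1 Rlt_0_1) in J.
- match type of J with jet _ _ ?c => replace (/ INR (S l) * (harmonic l / 2 - harmonic (2 * l + 1))) with c end;
    [exact J|].
  replace (INR (S (2 * l + 1))) with (2 * INR (S l))
    by (replace (S (2 * l + 1)) with (2 * S l)%nat by lia; rewrite mult_INR; reflexivity).
  field. apply not_0_INR; lia.
- intros h _. replace (2 * S l)%nat with (S (2 * l + 1)) by lia. rewrite E1, E2.
  replace (2 * h + 1) with (1 + 2 * h) by ring. replace (1 * h + 1) with (1 + h) by ring. field.
Qed.

(** The argument of [W] at s = 0 is 2l - (2i+1), which is the pole 1 exactly when l = i + 1; every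
    other term is regular with slope 0. *)
Lemma main_part_slope a W g N i : (S i <= N)%nat ->
  (forall t, t <> 1 -> ranalytic W t) -> jet (fun h => h * W (1 + h)) 1 g ->
  slope (main_part a (INR (2 * i + 1)) W N)
    (a ^ (2 * S i) / INR (S i) * (harmonic i / 2 - harmonic (2 * i + 1))).
Proof.
intros Hi HW HJ. unfold main_part.
set (v := a ^ (2 * S i) / INR (S i) * (harmonic i / 2 - harmonic (2 * i + 1))).
rewrite <- (sum_single (S i) N v Hi). apply slope_sum. intros l _.
destruct (Nat.eqb_spec l (S i)) as [->|Hne].
- unfold v. unfold Rdiv at 1. rewrite Rmult_assoc. apply slope_scal.
  replace (2 * INR (S i) - INR (2 * i + 1)) with 1
    by (rewrite S_INR, plus_INR, mult_INR; simpl INR; ring).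
  now apply (polar_term_slope W i g).
- replace 0 with (a ^ (2 * l) * 0) by ring. apply slope_scal.
  apply regular_term_slope, HW. intro E. apply Hne.
  apply INR_eq. rewrite S_INR. rewrite plus_INR, mult_INR in E. simpl INR in E. lra.
Qed.

(** * The spectral zeta function *)

Lemma sphere_mult_shift_nonneg p j : (1 <= j)%nat ->
  0 <= sphere_mult p (INR j - INR (2 * p + 1)).
Proof.
intro Hj. destruct (le_lt_dec j (2 * p)) as [H|H].
- rewrite sphere_mult_shift_0 by lia. lra.
- rewrite <- minus_INR by lia. apply sphere_mult_nonneg.
Qed.

Lemma Rpower_shift_up x s m : 0 < x -> Rpower x (- (s - INR m)) = x ^ m * Rpower x (- s).
Proof.
intro Hx. rewrite <- (Rpower_pow m x Hx), <- Rpower_plus. f_equal. ring.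
Qed.

Definition shifted_zeta_part (zr : R -> R) (p : nat) (s : R) : R :=
  sum_f_R0 (fun k => zeta_coef p k * zr (1 * s + - INR (2 * k + 1))) p +
  (-1) * Rpower (INR (2 * p + 1)) (- s).

(** The zeta functions sum [u + v], where [v] carries the multiplicity shifted by b = 2p + 1. Both
    are nonnegative, so they converge separately and [v] can be reindexed by [b]. The bound on [s]
    puts all the arguments s - (2k+1) above 1. *)
Lemma shifted_zeta_part_series (zr : R -> R) p s : INR (2 * p + 2) < s ->
  (forall s, 1 < s -> is_series (fun j => Rpower (INR (S j)) (- s)) (zr s)) ->
  is_series (fun j => sphere_mult p (INR (S j)) *
     (Rpower (INR (S j)) (- s) + Rpower (INR (S j) + INR (2 * p + 1)) (- s)))
    (shifted_zeta_part zr p s).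
Proof.
intros Hs Hz. set (b := (2 * p + 1)%nat).
set (u := fun j => sphere_mult p (INR (S j)) * Rpower (INR (S j)) (- s)).
set (v := fun j => sphere_mult p (INR (S j) - INR b) * Rpower (INR (S j)) (- s)).
assert (X : forall j, 0 < INR (S j)) by (intro; apply lt_0_INR; lia).
assert (T : is_series (fun j => u j + v j)
  (sum_f_R0 (fun k => zeta_coef p k * zr (1 * s + - INR (2 * k + 1))) p)).
{ assert (M := is_series_sum_f_R0
    (fun k j => zeta_coef p k * Rpower (INR (S j)) (- (s - INR (2 * k + 1))))
    (fun k => zeta_coef p k * zr (1 * s + - INR (2 * k + 1))) p).
  eapply is_series_ext; [|apply M].
  - intro j. cbv beta. unfold u, v, b.
    rewrite <- Rmult_plus_distr_r, sphere_mult_shift_sum by (apply Rgt_not_eq, X).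
    rewrite Rmult_comm, scal_sum. apply sum_eq. intros k _.
    rewrite Rpower_shift_up by apply X. ring.
  - intros k Hk. replace (1 * s + - INR (2 * k + 1)) with (s - INR (2 * k + 1)) by ring.
    refine (is_series_scal_l (zeta_coef p k) _ _ (Hz (s - INR (2 * k + 1)) _)).
    apply le_INR in Hk. rewrite plus_INR, mult_INR in Hs. rewrite plus_INR, mult_INR.
    simpl INR in *. lra. }
assert (Pu : forall j, 0 <= u j)
  by (intro j; apply Rmult_le_pos; [apply sphere_mult_nonneg|left; apply Rpower_pos]).
assert (Pv : forall j, 0 <= v j)
  by (intro j; apply Rmult_le_pos; [apply sphere_mult_shift_nonneg; lia|left; apply Rpower_pos]).
assert (Eu : ex_series u).
{ apply (ex_series_le (K := R_AbsRing) (V := R_CompleteNormedModule) _ (fun j => u j + v j)); [|eexists; exact T].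
  intro j. unfold norm; simpl. unfold abs; simpl. rewrite Rabs_pos_eq by apply Pu.
  specialize (Pv j). lra. }
assert (Tv : is_series v (sum_f_R0 (fun k => zeta_coef p k * zr (1 * s + - INR (2 * k + 1))) p - Series u)).
{ eapply is_series_ext; [|exact (is_series_minus _ _ _ _ T (Series_correct _ Eu))].
  intro j. unfold plus, opp; simpl. ring_R. }
assert (V0 : forall m, (m < 2 * p)%nat -> v m = 0).
{ intros m Hm. unfold v, b. rewrite sphere_mult_shift_0 by lia. ring. }
(* The first [b] terms, removed by the reindexing: all vanish except the last, where the
   multiplicity polynomial is taken at 0. *)
assert (Sv : sum_f_R0 v (2 * p) = Rpower (INR b) (- s)).
{ assert (Vb : v (2 * p)%nat = Rpower (INR b) (- s)).
  { unfold v. replace (S (2 * p)) with b by (unfold b; lia).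
    rewrite Rminus_diag, sphere_mult_0. ring. }
  rewrite <- Vb. destruct (2 * p)%nat as [|m]; [reflexivity|].
  rewrite tech5, sum_eq_R0; [ring|]. intros i Hi. apply V0. lia. }
assert (Tw : is_series (fun j => v (b + j)%nat)
  (sum_f_R0 (fun k => zeta_coef p k * zr (1 * s + - INR (2 * k + 1))) p - Series u - Rpower (INR b) (- s))).
{ apply (is_series_incr_n (K := R_AbsRing) (V := R_NormedModule) v b); [unfold b; lia|].
  replace (Init.Nat.pred b) with (2 * p)%nat by (unfold b; lia).
  refine (eq_ind _ (is_series v) Tv _ _). rewrite sum_n_Reals, Sv. unfold plus; simpl. ring_R. }
replace (shifted_zeta_part zr p s) with (Series u +
  (sum_f_R0 (fun k => zeta_coef p k * zr (1 * s + - INR (2 * k + 1))) p - Series u - Rpower (INR b) (- s)))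
  by (unfold shifted_zeta_part; fold b; ring).
eapply is_series_ext; [|exact (is_series_plus _ _ _ _ (Series_correct _ Eu) Tw)].
intro j. change (u j + v (b + j)%nat = sphere_mult p (INR (S j)) *
  (Rpower (INR (S j)) (- s) + Rpower (INR (S j) + INR b) (- s))). unfold u, v.
replace (INR (S (b + j))) with (INR (S j) + INR b) by (rewrite <- plus_INR; f_equal; lia).
replace (INR (S j) + INR b - INR b) with (INR (S j)) by ring. ring.
Qed.

(** One cutoff serves all [i <= p]: with q = 2i + 1 and d = p + 3 one has q + 4 <= 2p + 5 <= 2d, and
    the polar term l = i + 1 lies in the main part, which stops at p + 2. *)
Definition remaining_part (W : R -> R) (p : nat) (s : R) : R :=
  let a := INR p + / 2 in
  sum_f_R0 (fun i => cfact_odd_bar (S p) (S i) * 2 ^ (2 * i + 1) *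
    (main_part a (INR (2 * i + 1)) W (p + 2) s + remainder a (INR (2 * i + 1)) (p + 3) s)) p.

Lemma sphere_series_split (zr W : R -> R) p s : INR (2 * p + 2) < s ->
  (forall s, 1 < s -> is_series (fun j => Rpower (INR (S j)) (- s)) (zr s)) ->
  (forall s, 1 < s -> is_series (fun j => Rpower (INR j + (INR (S p) + / 2)) (- s)) (W s)) ->
  is_series (fun j => sphere_multiplicity (2 * S p) (S j) *
      Rpower (sphere_eigenvalue (2 * S p) (S j)) (- s))
    (shifted_zeta_part zr p s + remaining_part W p s).
Proof.
intros Hs Hz HW. set (a := INR p + / 2).
assert (Ha : 0 < a) by (unfold a; pose proof (pos_INR p); lra).
assert (HW' : forall s, 1 < s -> is_series (fun j => Rpower (INR j + (1 + a)) (- s)) (W s)).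
{ intros t Ht. eapply is_series_ext; [|exact (HW t Ht)]. intro j. cbv beta.
  unfold a. rewrite S_INR. f_equal. ring. }
assert (HA := shifted_zeta_part_series zr p s Hs Hz).
rewrite plus_INR, mult_INR in Hs. simpl INR in Hs.
assert (HB : is_series (fun j => sum_f_R0 (fun i => cfact_odd_bar (S p) (S i) * 2 ^ (2 * i + 1) *
   (let x := INR j + (1 + a) in Rpower x (INR (2 * i + 1)) *
      (Rpower (x ^ 2 - a ^ 2) (- s) - Rpower (x - a) (- s) - Rpower (x + a) (- s)))) p)
   (remaining_part W p s)).
{ apply (is_series_sum_f_R0 (fun i j => cfact_odd_bar (S p) (S i) * 2 ^ (2 * i + 1) *
   (let x := INR j + (1 + a) in Rpower x (INR (2 * i + 1)) *
      (Rpower (x ^ 2 - a ^ 2) (- s) - Rpower (x - a) (- s) - Rpower (x + a) (- s))))).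
  intros i Hi. refine (is_series_scal_l (cfact_odd_bar (S p) (S i) * 2 ^ (2 * i + 1)) _ _ _).
  replace (p + 2)%nat with (Init.Nat.pred (p + 3)) by lia.
  pose proof (pos_INR p). apply le_INR in Hi.
  apply expansion_sum; trivial; try lia; try lra;
    rewrite !plus_INR, mult_INR; simpl INR; lra. }
eapply is_series_ext; [|exact (is_series_plus _ _ _ _ HA HB)].
intro j. cbv beta. match goal with |- plus ?u ?v = ?w => change ((u : R) + v = w) end.
assert (X : 0 < INR (S j)) by (apply lt_0_INR; lia).
pose proof (pos_INR p).
rewrite sphere_mult_correct.
assert (E : sphere_eigenvalue (2 * S p) (S j) = INR (S j) * (INR (S j) + INR (2 * p + 1))).
{ unfold sphere_eigenvalue. rewrite <- plus_INR, <- mult_INR. f_equal. f_equal. lia. }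
rewrite E. set (Xj := INR (S j)) in *.
set (x := INR j + (1 + a)).
assert (Ex : x = Xj + INR p + / 2) by (unfold x, Xj, a; rewrite S_INR; ring).
assert (Eb : INR (2 * p + 1) = 2 * a) by (unfold a; rewrite plus_INR, mult_INR; simpl INR; field).
assert (Em : sphere_mult p Xj = sum_f_R0 (fun i => cfact_odd_bar (S p) (S i) * 2 ^ (2 * i + 1) * Rpower x (INR (2 * i + 1))) p).
{ rewrite sphere_mult_cfact, <- Ex by lra. apply sum_eq. intros i _.
  rewrite Rpower_pow, Rpow_mult_distr by lra. ring. }
assert (E1 : x - a = Xj) by (rewrite Ex; unfold a; ring).
assert (E2 : x + a = Xj + INR (2 * p + 1)) by (rewrite Eb, <- E1; ring).
assert (E3 : x ^ 2 - a ^ 2 = Xj * (Xj + INR (2 * p + 1))) by (rewrite <- E2, <- E1; ring).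
cbv zeta. fold x. rewrite E1, E2, E3.
(* The bracket does not depend on [i], so the sum over [i] restores the multiplicity, and the two
   subtracted powers cancel those of [HA]. *)
rewrite (sum_eq _ (fun i => cfact_odd_bar (S p) (S i) * 2 ^ (2 * i + 1) * Rpower x (INR (2 * i + 1)) *
  (Rpower (Xj * (Xj + INR (2 * p + 1))) (- s) - Rpower Xj (- s) - Rpower (Xj + INR (2 * p + 1)) (- s))))
  by (intros; ring).
rewrite <- scal_sum, <- Em. ring.
Qed.

(** For x = - h ln b one has 1 + x <= exp x <= 1/(1 - x). When |x| <= 1/2, which the chosen radius
    ensures, the excess x^2/(1 - x) over 1 + x is at most 2 x^2. *)
Lemma Rpower_slope b : slope (fun h => Rpower b (- h)) (- ln b).
Proof.
set (k := - ln b). exists 1.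
exists (2 * k ^ 2), (/ (2 * (Rabs k + 1))).
assert (Hk := Rabs_pos k).
split; [apply Rinv_0_lt_compat; lra|].
intros h [h0 h1].
assert (Hx : Rabs (k * h) <= / 2).
{ rewrite Rabs_mult, (Rabs_pos_eq h) by lra.
  apply (Rmult_lt_compat_r (2 * (Rabs k + 1))) in h1; [|lra].
  rewrite Rinv_l in h1 by lra. nra. }
replace (Rpower b (- h)) with (exp (k * h)) by (unfold Rpower, k; f_equal; ring).
replace (2 * k ^ 2 * h ^ 2) with (2 * (k * h) ^ 2) by ring.
set (x := k * h) in *. apply Rabs_le_between in Hx.
assert (L := exp_ineq1_le x). assert (U := exp_ineq1_le (- x)).
rewrite exp_Ropp in U. assert (P := exp_pos x).
assert (U' : exp x * (1 + - x) <= 1).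
{ apply (Rmult_le_compat_l (exp x)) in U; [|lra]. rewrite Rinv_r in U by lra. exact U. }
apply Rabs_le. split; [nra|].
apply (Rmult_le_reg_r (1 + - x)); [lra|]. nra.
Qed.

Lemma shifted_zeta_part_slope (zr : R -> R) (z' : nat -> R) p :
  (forall k, jet (fun h => zr (- INR (2 * k + 1) + h)) (zr (- INR (2 * k + 1))) (z' k)) ->
  slope (shifted_zeta_part zr p)
    (sum_f_R0 (fun k => zeta_coef p k * z' k) p + ln (INR (2 * p + 1))).
Proof.
intro Hz.
replace (ln (INR (2 * p + 1))) with ((-1) * (- ln (INR (2 * p + 1)))) by ring.
apply (slope_plus (fun s => sum_f_R0 (fun k => zeta_coef p k * zr (1 * s + - INR (2 * k + 1))) p)).
- apply (slope_sum (fun k s => zeta_coef p k * zr (1 * s + - INR (2 * k + 1)))).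
  intros k _. apply slope_scal. eexists.
  apply (jet_ext _ (fun h => zr (1 * h + - INR (2 * k + 1))) _ _ 1 Rlt_0_1) with (2 := Hz k).
  intros h _. f_equal. ring.
- apply slope_scal, Rpower_slope.
Qed.

Lemma remaining_part_slope (W : R -> R) g p :
  (forall t, t <> 1 -> ranalytic W t) -> jet (fun h => h * W (1 + h)) 1 g ->
  slope (remaining_part W p)
    (sum_f_R0 (fun i => cfact_odd_bar (S p) (S i) *
       ((2 * INR (S p) - 1) ^ (2 * S i) / (2 * INR (S i))) *
       (harmonic i / 2 - harmonic (2 * i + 1))) p).
Proof.
intros HW HJ. apply slope_sum. intros i Hi. set (a := INR p + / 2).
assert (Ha : 0 < a) by (unfold a; pose proof (pos_INR p); lra).
pose proof (pos_INR p). apply le_INR in Hi as Hi'.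
(* With 2a = 2n - 1, the factor 2^(2i+1) a^(2i+2)/(i+1) is (2n-1)^(2i+2)/(2(i+1)); the added 0 is
   the slope of the remainder. *)
replace (cfact_odd_bar (S p) (S i) * ((2 * INR (S p) - 1) ^ (2 * S i) / (2 * INR (S i))) *
   (harmonic i / 2 - harmonic (2 * i + 1)))
  with (cfact_odd_bar (S p) (S i) * 2 ^ (2 * i + 1) *
     (a ^ (2 * S i) / INR (S i) * (harmonic i / 2 - harmonic (2 * i + 1)) + 0)).
- apply slope_scal, slope_plus.
  + apply (main_part_slope a W g); [lia|exact HW|exact HJ].
  + exists 0. apply remainder_flat; [exact Ha| |lia].
    rewrite !plus_INR, mult_INR; simpl INR; lra.
- replace (2 * INR (S p) - 1) with (2 * a) by (unfold a; rewrite S_INR; field).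
  rewrite Rpow_mult_distr. replace (2 ^ (2 * S i)) with (2 * 2 ^ (2 * i + 1)).
  + field. apply not_0_INR; lia.
  + rewrite tech_pow_Rmult. f_equal. lia.
Qed.

Lemma shifted_zeta_part_meromorphic (zr : R -> R) p t :
  (forall s, rmeromorphic zr s) -> rmeromorphic (shifted_zeta_part zr p) t.
Proof.
intro Hz.
apply (rmeromorphic_plus (fun s => sum_f_R0 (fun k => zeta_coef p k * zr (1 * s + - INR (2 * k + 1))) p)).
- apply (rmeromorphic_sum (fun k s => zeta_coef p k * zr (1 * s + - INR (2 * k + 1)))).
  intros k _. apply (rmeromorphic_mult (fun _ => zeta_coef p k)); [apply rmeromorphic_const|].
  apply rmeromorphic_comp_affine; [lra|apply Hz].
- apply (rmeromorphic_mult (fun _ => -1)); [apply rmeromorphic_const|].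
  apply ranalytic_rmeromorphic.
  apply (ranalytic_ext (fun s => Rpower (INR (2 * p + 1)) (-1 * s + 0))).
  + intro s. f_equal. ring.
  + apply ranalytic_comp_affine; [lra|apply Rpower_analytic].
Qed.

Lemma remaining_part_meromorphic (W : R -> R) p t : - (1 / 2) <= t ->
  (forall s, rmeromorphic W s) -> rmeromorphic (remaining_part W p) t.
Proof.
intros Ht HW. apply rmeromorphic_sum. intros i Hi. set (a := INR p + / 2).
assert (Ha : 0 < a) by (unfold a; pose proof (pos_INR p); lra).
pose proof (pos_INR p). apply le_INR in Hi as Hi'.
apply (rmeromorphic_mult (fun _ => cfact_odd_bar (S p) (S i) * 2 ^ (2 * i + 1))); [apply rmeromorphic_const|].
apply (rmeromorphic_plus (main_part a (INR (2 * i + 1)) W (p + 2))).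
- now apply main_part_meromorphic.
- apply ranalytic_rmeromorphic, remainder_analytic; [exact Ha| |lia|exact Ht].
  rewrite !plus_INR, mult_INR; simpl INR; lra.
Qed.

Lemma sphere_zeta_real_series N (Zs : C -> C) : is_sphere_zeta N Zs ->
  exists sigma, forall s, sigma < s ->
    is_series (fun j => sphere_multiplicity N (S j) *
       Rpower (sphere_eigenvalue N (S j)) (- s)) (Re (Zs (RtoC s))) /\
    Im (Zs (RtoC s)) = 0.
Proof.
intros [_ [_ [sigma H]]]. exists sigma. intros s Hs. specialize (H (RtoC s) Hs).
apply is_series_Re in H. destruct H as [H1 H2]. split.
- eapply is_series_ext; [|exact H1]. intro j. cbv beta.
  rewrite <- RtoC_opp, Cpow_pos_real, <- RtoC_mult. reflexivity.
- rewrite <- (is_series_unique _ _ H2).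
  rewrite (Series_ext _ (fun j => 0 * 0)); [rewrite Series_scal_l; ring|].
  intro j. rewrite <- RtoC_opp, Cpow_pos_real, <- RtoC_mult. simpl. ring.
Qed.

Lemma sphere_zeta_derivative p (zeta Zs : C -> C) :
  is_Riemann_zeta zeta -> is_sphere_zeta (2 * S p) Zs ->
  Re (C_derive Zs (RtoC 0)) =
    sum_f_R0 (fun k => zeta_coef p k * Re (C_derive zeta (RtoC (- INR (2 * k + 1))))) p +
    ln (INR (2 * p + 1)) +
    sum_f_R0 (fun i => cfact_odd_bar (S p) (S i) *
       ((2 * INR (S p) - 1) ^ (2 * S i) / (2 * INR (S i))) *
       (harmonic i / 2 - harmonic (2 * i + 1))) p.
Proof.
intros hzeta hZ. set (zr := fun s => Re (zeta (RtoC s))).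
destruct (shifted_zeta zeta hzeta (S p) ltac:(lia)) as [W [Wm [Wa Ws]]].
assert (Hc : 1 <= INR (S p) + / 2) by (rewrite S_INR; pose proof (pos_INR p); lra).
destruct (power_sum_residue W _ Hc (Wm 1) Ws) as [g Hg].
destruct (sphere_zeta_real_series _ _ hZ) as [sigma HZ].
assert (Hz : forall s, 1 < s -> is_series (fun j => Rpower (INR (S j)) (- s)) (zr s))
  by (intros s Hs; now apply zeta_real_series).
set (F := fun s => shifted_zeta_part zr p s + remaining_part W p s).
(* The remainder is analytic from -1/2 on, which is enough to continue the identity to a
   neighbourhood of 0. *)
destruct (rmeromorphic_identity (fun s => Re (Zs (RtoC s)) + (-1) * F s) (- (1 / 2))
  (Rmax sigma (INR (2 * p + 2)))) with (t := 0) as [d [Hd HD]].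
- intros t Ht. apply (rmeromorphic_plus (fun s => Re (Zs (RtoC s)))).
  + apply meromorphic_at_real, hZ.
  + apply (rmeromorphic_mult (fun _ => -1)); [apply rmeromorphic_const|].
    apply (rmeromorphic_plus (shifted_zeta_part zr p)).
    * apply shifted_zeta_part_meromorphic. intro s. now apply zeta_real_meromorphic.
    * apply remaining_part_meromorphic; [lra|exact Wm].
- intros t Ht.
  assert (sigma < t) by (eapply Rle_lt_trans; [apply Rmax_l|exact Ht]).
  assert (INR (2 * p + 2) < t) by (eapply Rle_lt_trans; [apply Rmax_r|exact Ht]).
  destruct (HZ t) as [S1 _]; [assumption|].
  assert (S2 := sphere_series_split zr W p t ltac:(assumption) Hz Ws).
  assert (Q := eq_trans (eq_sym (is_series_unique _ _ S1)) (is_series_unique _ _ S2)).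
  rewrite Q. unfold F. ring.
- lra.
- destruct hZ as [_ [Za _]]. destruct (C_derive_jet Zs 0 Za) as [J _].
  destruct (slope_plus _ _ _ _
    (shifted_zeta_part_slope zr (fun k => Re (C_derive zeta (RtoC (- INR (2 * k + 1))))) p
      ltac:(intro k; apply zeta_derive_jet; [exact hzeta|pose proof (pos_INR (2 * k + 1)); lra]))
    (remaining_part_slope W g p Wa Hg)) as [c0 K].
  (* [Zs] and [F] agree off 0, and a jet does not see 0 itself. Only first-order coefficients are
     compared; [c0] is never evaluated. *)
  refine (proj2 (jet_unique _ _ _ c0 _ J _)).
  apply (jet_ext F _ _ _ d Hd); [|exact K].
  intros h Hh. specialize (HD h ltac:(lra) ltac:(rewrite Rabs_pos_eq; lra)).
  cbv beta in HD. rewrite Rplus_0_l in *. lra.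
Qed.

(** * Return to complex values *)

Lemma sum_n_m_R_shift (f : nat -> R) p :
  sum_n_m (G := R_AbelianMonoid) f 1 (S p) = sum_f_R0 (fun k => f (S k)) p.
Proof. rewrite <- sum_n_m_S. apply sum_n_Reals. Qed.

Lemma sum_n_m_C_real (f : nat -> C) (g : nat -> R) p :
  (forall k, f (S k) = RtoC (g k)) ->
  sum_n_m (G := C_AbelianMonoid) f 1 (S p) = RtoC (sum_f_R0 g p).
Proof.
intro H. rewrite <- sum_n_m_S.
change (sum_n_m (fun k => f (S k)) 0 p) with (sum_n (G := C_AbelianMonoid) (fun k => f (S k)) p).
induction p as [|p IH]; [rewrite sum_O; apply H|].
rewrite sum_Sn, IH, H, tech5, RtoC_plus. reflexivity.
Qed.

Theorem theorem2p8 (n : nat) (hn : (1 <= n)%nat)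
    (zeta : C -> C) (hzeta : is_Riemann_zeta zeta)
    (Zs : C -> C) (hZ : is_sphere_zeta (2 * n) Zs) :
  Im (zeta_det Zs) = 0 /\ 0 < Re (zeta_det Zs) /\
  RtoC (- ln (Re (zeta_det Zs))) = C_derive Zs (RtoC 0) /\
  C_derive Zs (RtoC 0) =
    (RtoC (2 / INR (fact (2 * n - 1)))%R *
       sum_n_m (G := C_AbelianMonoid)
         (fun k => C_derive zeta (RtoC (- 2 * INR k + 1)%R) *
            RtoC (IZR (stirling1 (2 * n - 1) (2 * k - 1)
                       + stirling1 (2 * n) (2 * k))))
         1 n
     + RtoC (sum_n_m (G := R_AbelianMonoid)
         (fun i => cfact_odd_bar n i *
            ((2 * INR n - 1) ^ (2 * i) / (2 * INR i)) *
            (harmonic (i - 1) / 2 - harmonic (2 * i - 1)))%R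
         1 n)
     + RtoC (ln (2 * INR n - 1)%R))%C.
Proof.
destruct n as [|p]; [lia|].
(* The Dirichlet series is real at large real arguments, so the derivative at 0 is real; this makes
   the determinant a positive real and reduces the formula to its real part. *)
assert (hz0 : Im (C_derive Zs (RtoC 0)) = 0).
{ destruct (sphere_zeta_real_series _ _ hZ) as [sigma HZ].
  apply (real_C_derive Zs sigma); [apply hZ| |apply hZ].
  intros s Hs. now apply HZ. }
assert (hD := sphere_zeta_derivative p zeta Zs hzeta hZ).
assert (hC : C_derive Zs (RtoC 0) = RtoC (Re (C_derive Zs (RtoC 0)))).
{ apply injective_projections; [reflexivity|exact hz0]. }
set (D := Re (C_derive Zs (RtoC 0))) in *.
assert (hdet : zeta_det Zs = RtoC (exp (- D))).
{ unfold zeta_det. rewrite hC. unfold Cexp, RtoC, Copp, Re, Im; simpl.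
  rewrite Ropp_0, cos_0, sin_0. f_equal; ring. }
rewrite hdet, hC. split; [reflexivity|]. split; [apply exp_pos|].
split; [simpl; now rewrite ln_exp, Ropp_involutive|].
(* The derivatives of [zeta] at negative odd integers are real, so the complex sum is a real one,
   reindexed from 0. *)
rewrite (sum_n_m_C_real _ (fun k => Re (C_derive zeta (RtoC (- INR (2 * k + 1)))) *
  IZR (stirling1 (2 * p + 1) (2 * k + 1) + stirling1 (2 * p + 2) (2 * k + 2)))).
- rewrite sum_n_m_R_shift, <- RtoC_mult, <- !RtoC_plus. f_equal. rewrite hD.
  replace (2 * S p - 1)%nat with (2 * p + 1)%nat by lia.
  replace (2 * INR (S p) - 1) with (INR (2 * p + 1))
    by (rewrite S_INR, plus_INR, mult_INR; simpl INR; ring).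
  rewrite scal_sum.
  rewrite (sum_eq (fun k => zeta_coef p k * _) (fun k =>
    Re (C_derive zeta (RtoC (- INR (2 * k + 1)))) *
      IZR (stirling1 (2 * p + 1) (2 * k + 1) + stirling1 (2 * p + 2) (2 * k + 2)) *
    (2 / INR (fact (2 * p + 1))))) by (intros; unfold zeta_coef; ring).
  rewrite (sum_eq (fun i => cfact_odd_bar (S p) (S i) * _ * (harmonic i / 2 - harmonic (2 * i + 1)))
    (fun k => cfact_odd_bar (S p) (S k) * (INR (2 * p + 1) ^ (2 * S k) / (2 * INR (S k))) *
      (harmonic (S k - 1) / 2 - harmonic (2 * S k - 1)))).
  + ring.
  + intros i _. replace (S i - 1)%nat with i by lia.
    replace (2 * S i - 1)%nat with (2 * i + 1)%nat by lia. reflexivity.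
- intro k. replace (2 * S p - 1)%nat with (2 * p + 1)%nat by lia.
  replace (2 * S k - 1)%nat with (2 * k + 1)%nat by lia.
  replace (2 * S p)%nat with (2 * p + 2)%nat by lia.
  replace (2 * S k)%nat with (2 * k + 2)%nat by lia.
  replace (- 2 * INR (S k) + 1) with (- INR (2 * k + 1))
    by (rewrite S_INR, plus_INR, mult_INR; simpl INR; ring).
  rewrite RtoC_mult. f_equal.
  apply injective_projections; [reflexivity|].
  apply zeta_derive_jet; [exact hzeta|].
  pose proof (pos_INR (2 * k + 1)). lra.
Qed.
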